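(* Let $G$ be a connected affine algebraic group with Lie algebra $\mathfrak g$, let $V$ be a finite-dimensional rational $G$-module, and let $\hat\tau:\mathrm{Mor}(\mathfrak g,V)\to\mathrm{Mor}(\mathfrak g,V)$ be given by $\hat\tau(F)(x)=x\cdot F(x)$. For $x\in\mathfrak g$ put $V^x=\{v\in V\mid x\cdot v=0\}$, set $\Omega_\tau=\{x\in\mathfrak g\mid\dim V^x\text{ is minimal}\}$ and $$E'_\tau=\{(x,v)\in\Omega_\tau\times V\mid x\cdot v=0\},$$ a vector bundle on $\Omega_\tau$. Suppose $E'_\tau$ is a trivial vector bundle and $\mathrm{codim}(\mathfrak g\setminus\Omega_\tau)\ge3$. Then $$\mathrm{Im}\,\hat\tau=\{\mathcal F\in\mathrm{Mor}(\mathfrak g,V)\mid\mathcal F(x)\in x\cdot V\ \ \forall x\in\mathfrak g\}.$$ In other words, if $\mathcal F\in\mathrm{Mor}(\mathfrak g,V)$ satisfies $\mathcal F(x)\in x\cdot V$ for all $x\in\Omega_\tau$, then there is $F\in\mathrm{Mor}(\mathfrak g,V)$ such that $\mathcal F(x)=x\cdot F(x)$ for all $x\in\mathfrak g$.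
   Context: The base field $\Bbbk$ is algebraically closed of characteristic $0$. $\mathrm{Mor}(\mathfrak g,V)$ is the $\Bbbk[\mathfrak g]$-module of polynomial morphisms $\mathfrak g\to V$. For $x\in\mathfrak g$, $x\cdot V=\{x\cdot v\mid v\in V\}$. The empty set has codimension $\infty$. Triviality of $E'_\tau$ is as an algebraic vector bundle on $\Omega_\tau$. *)

(* Defs.v *)
(* Affine algebraic groups, rational modules and their infinitesimal action,
   over a field k, in the classical language of closed subsets of affine
   spaces. An affine space is (the underlying set of) a finite-dimensional
   vector space U : vectType k, with the coordinates v2r : U -> 'rV_(dim U);
   the notions below do not depend on this choice of linear coordinates. *)
From Stdlib Require Import Classical ClassicalEpsilon.
From HB Require Import structures.
From mathcomp Require Import all_boot all_order all_algebra.
From mathcomp Require Import mpoly.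

Set Implicit Arguments.
Unset Strict Implicit.
Unset Printing Implicit Defensive.

Import GRing.Theory VectorInternalTheory.
Local Open Scope ring_scope.

(** * Polynomial functions and polynomial morphisms *)

Definition polyfun (k : fieldType) (U : vectType k) : Type :=
  {mpoly k[dim U]}.

Definition peval (k : fieldType) (U : vectType k) (p : polyfun U) (u : U) : k :=
  p.@[v2r u 0].

Definition polymap (k : fieldType) (U W : vectType k) : Type :=
  'I_(dim W) -> polyfun U.

Definition pmeval (k : fieldType) (U W : vectType k) (P : polymap U W) (u : U)
  : W := r2v (\row_j peval (P j) u).

(* Mor F : the set-theoretic map F : U -> W is a polynomial morphism. *)
Definition Mor (k : fieldType) (U W : vectType k) (F : U -> W) : Prop :=
  exists P : polymap U W, forall u, F u = pmeval P u.

(* d_a p (v) = \sum_i (dp/dx_i)(a) v_i *)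
Definition pdiff (k : fieldType) (U : vectType k) (p : polyfun U) (a v : U)
  : k := \sum_(i < dim U) p^`M(i).@[v2r a 0] * v2r v 0 i.

Definition pmdiff (k : fieldType) (U W : vectType k) (P : polymap U W)
  (a v : U) : W := r2v (\row_j pdiff (P j) a v).

(** * Zariski topology *)

Definition zclosed (k : fieldType) (U : vectType k) (X : U -> Prop) : Prop :=
  exists S : polyfun U -> Prop,
    forall u, X u <-> (forall p, S p -> peval p u = 0).

Definition zirreducible (k : fieldType) (U : vectType k) (Y : U -> Prop)
  : Prop :=
  (exists u, Y u) /\
  forall A B : U -> Prop, zclosed A -> zclosed B ->
    (forall u, Y u -> A u \/ B u) ->
    (forall u, Y u -> A u) \/ (forall u, Y u -> B u).

(* codim_ge Z n : the closed subset Z of the affine space U has codimension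
   at least n, where codim Z is the infimum, over the irreducible closed
   subsets Y of Z, of the supremum of the lengths of the chains
   Y = C_0 < C_1 < ... < C_n of irreducible closed subsets of U. In
   particular the empty set has infinite codimension. *)
Definition codim_ge (k : fieldType) (U : vectType k) (Z : U -> Prop) (n : nat)
  : Prop :=
  forall Y : U -> Prop, zclosed Y -> zirreducible Y ->
    (forall u, Y u -> Z u) ->
    exists C : nat -> U -> Prop,
      [/\ forall u, C 0%N u <-> Y u,
          forall i, (i <= n)%N -> zclosed (C i) /\ zirreducible (C i)
        & forall i, (i < n)%N ->
            (forall u, C i u -> C i.+1 u) /\ (exists u, C i.+1 u /\ ~ C i u)].

(* Regular maps on a locally closed subset X of an affine space, with values
   in an affine space: locally, a quotient of a polynomial morphism by a
   polynomial function. The values of f outside of X are irrelevant. *)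
Definition regular_on (k : fieldType) (U W : vectType k) (X : U -> Prop)
  (f : U -> W) : Prop :=
  forall x, X x ->
    exists (q : polyfun U) (P : polymap U W), peval q x != 0 /\
      forall y, X y -> peval q y != 0 -> f y = (peval q y)^-1 *: pmeval P y.

(* For E a subset of X x V whose fibres over X are linear subspaces of V:
   there are mutually inverse morphisms of varieties X x k^r <-> E over X
   that are linear on the fibres. *)
Definition trivial_bundle (k : fieldType) (U V : vectType k) (X : U -> Prop)
  (E : U * V -> Prop) : Prop :=
  exists (r : nat) (phi : U * 'rV[k]_r -> U * V) (psi : U * V -> U * 'rV[k]_r),
    [/\ regular_on (fun a => X a.1) phi,
        regular_on E psi,
        forall a, X a.1 -> [/\ E (phi a), (phi a).1 = a.1 & psi (phi a) = a],
        forall e, E e -> [/\ X (psi e).1, (psi e).1 = e.1 & phi (psi e) = e]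
      & forall x, X x -> forall (c : k) (v w : 'rV[k]_r),
          (phi (x, c *: v + w)).2 = c *: (phi (x, v)).2 + (phi (x, w)).2].

(** * Affine algebraic groups *)

(* The structure of affine variety on the group is given by a closed
   embedding into an affine space. *)
Record affineAlgGroup (k : fieldType) := AffineAlgGroup {
  agsort :> groupType;
  agspace : vectType k;
  agemb : agsort -> agspace;
  agemb_inj : injective agemb;
  agemb_closed : zclosed (fun u => exists g, agemb g = u);
  agmul_regular : exists P : polymap (agspace * agspace)%type agspace,
    forall g h, agemb (g * h)%g = pmeval P (agemb g, agemb h);
  aginv_regular : exists P : polymap agspace agspace,
    forall g, agemb (g^-1)%g = pmeval P (agemb g)
}.

Definition agclosed (k : fieldType) (G : affineAlgGroup k) (A : G -> Prop)
  : Prop :=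
  exists X : agspace G -> Prop, zclosed X /\ forall g, A g <-> X (agemb g).

Definition agconnected (k : fieldType) (G : affineAlgGroup k) : Prop :=
  forall A B : G -> Prop, agclosed A -> agclosed B ->
    (forall g, A g \/ B g) -> (forall g, ~ (A g /\ B g)) ->
    (forall g, A g) \/ (forall g, B g).

Definition agregular (k : fieldType) (G : affineAlgGroup k) (W : vectType k)
  (f : G -> W) : Prop :=
  exists P : polymap (agspace G) W, forall g, f g = pmeval P (agemb g).

(** * The Lie algebra, as the tangent space at the identity *)

Definition agtangent1 (k : fieldType) (G : affineAlgGroup k) (v : agspace G)
  : Prop :=
  forall p : polyfun (agspace G), (forall g : G, peval p (agemb g) = 0) ->
    pdiff p (agemb (1%g : G)) v = 0.

Lemma vspace_of_pred (k : fieldType) (U : vectType k) (P : U -> Prop) :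
  P 0 -> (forall (c : k) u v, P u -> P v -> P (c *: u + v)) ->
  exists W : {vspace U}, forall v, v \in W <-> P v.
Proof.
move=> P0 Plin.
have PD u v : P u -> P v -> P (u + v) by move=> Pu; rewrite -[u]scale1r; exact: Plin.
suff H n (W : {vspace U}) : (forall v, v \in W -> P v) ->
    (dim U <= \dim W + n)%N -> exists W : {vspace U}, forall v, v \in W <-> P v.
  by apply: (H (dim U) 0%VS) => [v|]; rewrite ?leq_addl // memv0 => /eqP->.
elim: n W => [|n IHn] W sWP leW.
  exists W => v; split=> [/sWP //|_].
  have /eqP-> : W == fullv by rewrite eqEdim subvf dimvf -[\dim W]addn0.
  exact: memvf.
have [[v [Pv nWv]]|noext] := classic (exists v, P v /\ v \notin W); last first.
  exists W => v; split=> [/sWP //|Pv]; apply/negPn/negP => nWv.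
  by apply: noext; exists v.
apply: (IHn (W + <[v]>)%VS) => [u /memv_addP[w Ww [_ /vlineP[c ->] ->]]|].
  by rewrite addrC; apply: Plin => //; exact: sWP.
apply: leq_trans leW _; rewrite addnS -addSn leq_add2r.
rewrite ltnNge; apply/negP => leWv.
have /eqP eqW : W == (W + <[v]>)%VS by rewrite eqEdim addvSl.
by case/negP: nWv; rewrite eqW; apply: (subvP (addvSr W <[v]>)); exact: memv_line.
Qed.

Lemma pdiff_linear (k : fieldType) (U : vectType k) (p : polyfun U) (a : U) :
  scalar (pdiff p a).
Proof.
move=> c u v; rewrite /pdiff mulr_sumr -big_split /=.
apply: eq_bigr => i _; rewrite linearP !mxE mulrDr; congr (_ + _).
by rewrite mulrCA.
Qed.

Lemma Lie_exists (k : fieldType) (G : affineAlgGroup k) :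
  exists W : {vspace agspace G}, forall v, v \in W <-> agtangent1 v.
Proof.
apply: vspace_of_pred => [p _|c u v Tu Tv p pG].
  by apply: big1 => i _; rewrite linear0 mxE mulr0.
by rewrite pdiff_linear Tu // Tv // mulr0 addr0.
Qed.

Definition Lie (k : fieldType) (G : affineAlgGroup k) : {vspace agspace G} :=
  proj1_sig (constructive_indefinite_description _ (Lie_exists G)).

Lemma LieP (k : fieldType) (G : affineAlgGroup k) (v : agspace G) :
  v \in Lie G <-> agtangent1 v.
Proof. by rewrite /Lie; case: constructive_indefinite_description. Qed.

Definition lieType (k : fieldType) (G : affineAlgGroup k) : vectType k :=
  subvs_of (Lie G).

(* The differential at the identity of a regular map on G is computed from
   any polynomial morphism extending it to the ambient affine space; agdiffE
   shows that the extension does not matter. *)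
Definition agdiff (k : fieldType) (G : affineAlgGroup k) (W : vectType k)
  (f : G -> W) (freg : agregular f) (x : lieType G) : W :=
  pmdiff (proj1_sig (constructive_indefinite_description _ freg))
    (agemb (1%g : G)) (vsval x).

Lemma agdiffE (k : fieldType) (G : affineAlgGroup k) (W : vectType k)
  (f : G -> W) (freg : agregular f) (P : polymap (agspace G) W) :
  (forall g, f g = pmeval P (agemb g)) ->
  forall x, agdiff freg x = pmdiff P (agemb (1%g : G)) (vsval x).
Proof.
move=> fP x; rewrite /agdiff.
case: constructive_indefinite_description => Q fQ /=.
congr r2v; apply/rowP=> j; rewrite !mxE; apply/eqP; rewrite -subr_eq0.
have /LieP Tx : vsval x \in Lie G by exact: subvsP.
have := Tx (Q j - P j); rewrite /pdiff => Txj.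
rewrite -sumrB -[X in _ == X]Txj.
  apply/eqP/eq_bigr => i _.
  by rewrite mderivB mevalB mulrBl.
move=> g; have := fP g; rewrite fQ => /(can_inj r2vK)/rowP/(_ j).
by rewrite !mxE /peval mevalB => ->; rewrite subrr.
Qed.

(** * Rational modules *)

Record rationalModule (k : fieldType) (G : affineAlgGroup k) (V : vectType k)
  := RationalModule {
  rep : G -> 'End(V);
  rep1 : rep 1%g = \1%VF;
  repM : forall g h : G, rep (g * h)%g = (rep g \o rep h)%VF;
  rep_regular : agregular rep
}.

(* act rho x v is x . v, for x in the Lie algebra of G and v in V. *)
Definition act (k : fieldType) (G : affineAlgGroup k) (V : vectType k)
  (rho : rationalModule G V) : lieType G -> 'End(V) :=
  agdiff (rep_regular rho).

(* V^x *)
Definition annV (k : fieldType) (G : affineAlgGroup k) (V : vectType k)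
  (rho : rationalModule G V) (x : lieType G) : {vspace V} :=
  lker (act rho x).

(* x . V *)
Definition actV (k : fieldType) (G : affineAlgGroup k) (V : vectType k)
  (rho : rationalModule G V) (x : lieType G) : {vspace V} :=
  limg (act rho x).

Definition tauhat (k : fieldType) (G : affineAlgGroup k) (V : vectType k)
  (rho : rationalModule G V) (F : lieType G -> V) : lieType G -> V :=
  fun x => act rho x (F x).

Definition Omega (k : fieldType) (G : affineAlgGroup k) (V : vectType k)
  (rho : rationalModule G V) (x : lieType G) : Prop :=
  forall y : lieType G, (\dim (annV rho x) <= \dim (annV rho y))%N.

Definition E' (k : fieldType) (G : affineAlgGroup k) (V : vectType k)
  (rho : rationalModule G V) (e : lieType G * V) : Prop :=
  Omega rho e.1 /\ act rho e.1 e.2 = 0.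

(* Main.v *)
(* Let Z be the complement of Omega. Linear Noether normalization yields
   polynomials p1, p2, p3 vanishing on Z all of whose powers form a regular
   sequence; this is where codim Z >= 3 enters. Regular functions on Omega then
   extend to polynomials, so that a trivialization of E' gives a basis Phi of
   the module of polynomial sections killed by the action. Near each point of
   Omega the map cF lifts with a polynomial denominator, whence by the
   Nullstellensatz p_i^N cF = x . G_i for some polynomial G_i. The differences
   of the G_i / p_i^N have coordinates in Phi which form a Cech cocycle on the
   three open sets p_i <> 0; the Koszul relations for the regular sequence make
   it a coboundary, and the corrected lifts glue. *)
Require Import Defs.
From Stdlib Require Import Classical ClassicalEpsilon.
From HB Require Import structures.
From mathcomp Require Import all_boot all_order all_algebra.
From mathcomp Require Import mpoly ring.
From mathcomp Require classical_sets.
Import GRing.Theory VectorInternalTheory Pdiv.Ring Pdiv.RingMonic.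
Local Open Scope ring_scope.
Set Implicit Arguments.
Unset Strict Implicit.
Unset Printing Implicit Defensive.

(** * Linear changes of coordinates *)

(** Over Omega the action has constant rank, so the obstruction to a global lift is a class in H^1
    of Omega with values in the kernel bundle E'. Triviality of E' reduces it to copies of
    H^1(Omega, O), which vanishes in codimension at least 3; two polynomials [p1], [p2] only suffice
    to extend functions. No cohomology is set up: every comparison is a polynomial identity, checked
    on Omega. Powers p_i^N arise because the Nullstellensatz only puts some power of p_i into an
    ideal of denominators. Codimension is given by chains of irreducible closed sets, whereas
    normalization needs algebraic relations modulo the ideal of Z. The bridge is that each strict
    step up a chain adds one algebraically independent function, and at most dim U such functions
    exist. Hence a polynomial ring in more than dim U - 3 variables mapped to k[U] over k always has
    a nonzero element sent into the ideal of Z; applied three times, this yields p1, p2, p3. *)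

Lemma mpoly_rmorph_ext (n : nat) (R : comNzRingType) (S : nzRingType)
    (f g : {rmorphism {mpoly R[n]} -> S}) :
  (forall c, f c%:MP = g c%:MP) -> (forall i, f 'X_i = g 'X_i) -> f =1 g.
Proof.
move=> fgC fgX p; rewrite (mpolyE p) !raddf_sum /=; apply: eq_bigr => m _.
rewrite -mul_mpolyC mpolyXE_id !rmorphM fgC !rmorph_prod; congr (_ * _).
by apply: eq_bigr => i _; rewrite !rmorphXn fgX.
Qed.

Lemma poly_rmorph_ext (R S : nzRingType) (f g : {rmorphism {poly R} -> S}) :
  (forall c, f c%:P = g c%:P) -> f 'X = g 'X -> f =1 g.
Proof.
move=> fgC fgX p; rewrite -[p]coefK poly_def !raddf_sum /=; apply: eq_bigr => i _.
by rewrite -mul_polyC !rmorphM fgC !rmorphXn fgX.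
Qed.

(* X_i |-> X_i + l_i t and X_max |-> l_max t, where t is the new variable 'X. *)
Definition shear_var (k : fieldType) (n : nat) (l : 'I_n.+1 -> k) (i : 'I_n.+1) :
    {poly {mpoly k[n]}} :=
  (if unlift ord_max i is Some j then 'X_j else 0)%:P + (l i)%:MP *: 'X.

Definition shear (k : fieldType) (n : nat) (l : 'I_n.+1 -> k)
    (p : {mpoly k[n.+1]}) : {poly {mpoly k[n]}} :=
  mmap (@polyC {mpoly k[n]} \o @mpolyC n k) (shear_var l) p.

HB.instance Definition _ (k : fieldType) (n : nat) (l : 'I_n.+1 -> k) :=
  GRing.RMorphism.copy (shear l)
    (mmap (@polyC {mpoly k[n]} \o @mpolyC n k) (shear_var l)).

Definition unshear_var (k : fieldType) (n : nat) (l : 'I_n.+1 -> k) (j : 'I_n) :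
    {mpoly k[n.+1]} :=
  'X_(lift ord_max j) - (l (lift ord_max j) / l ord_max) *: 'X_ord_max.

Definition unshear (k : fieldType) (n : nat) (l : 'I_n.+1 -> k)
    (q : {poly {mpoly k[n]}}) : {mpoly k[n.+1]} :=
  (map_poly (mmap (@mpolyC n.+1 k) (unshear_var l)) q).[
    (l ord_max)^-1 *: 'X_ord_max].

HB.instance Definition _ (k : fieldType) (n : nat) (l : 'I_n.+1 -> k) :=
  GRing.RMorphism.copy (unshear l)
    (horner_eval ((l ord_max)^-1 *: 'X_ord_max)
       \o map_poly (mmap (@mpolyC n.+1 k) (unshear_var l))).

Lemma shearC (k : fieldType) (n : nat) (l : 'I_n.+1 -> k) c :
  shear l c%:MP = (c%:MP)%:P.
Proof. exact: mmapC. Qed.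

Lemma shearX (k : fieldType) (n : nat) (l : 'I_n.+1 -> k) i :
  shear l 'X_i = shear_var l i.
Proof. by rewrite [LHS]mmapX mmap1U. Qed.

Lemma unshearP (k : fieldType) (n : nat) (l : 'I_n.+1 -> k) c :
  unshear l c%:P = mmap (@mpolyC n.+1 k) (unshear_var l) c.
Proof. by rewrite /unshear map_polyC hornerC. Qed.

Lemma unshearX (k : fieldType) (n : nat) (l : 'I_n.+1 -> k) :
  unshear l 'X = (l ord_max)^-1 *: 'X_ord_max.
Proof. by rewrite /unshear map_polyX hornerX. Qed.

Lemma unshearK (k : fieldType) (n : nat) (l : 'I_n.+1 -> k) :
  l ord_max != 0 -> cancel (shear l) (unshear l).
Proof.
move=> lN0 p; apply: (@mpoly_rmorph_ext _ _ _ (unshear l \o shear l) idfun) => [c|i] /=.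
  by rewrite shearC unshearP mmapC.
rewrite shearX rmorphD -mul_polyC rmorphM /= !unshearP unshearX mmapC mul_mpolyC.
case: unliftP => [j ->|->].
  by rewrite mmapX mmap1U scalerA subrK.
by rewrite mmap0 add0r scalerA divff // scale1r.
Qed.

Lemma shearK (k : fieldType) (n : nat) (l : 'I_n.+1 -> k) :
  l ord_max != 0 -> cancel (unshear l) (shear l).
Proof.
move=> lN0 q; apply: (@poly_rmorph_ext _ _ (shear l \o unshear l) idfun) => [c|] /=.
  rewrite unshearP.
  apply: (@mpoly_rmorph_ext _ _ _ (shear l \o mmap (@mpolyC n.+1 k) (unshear_var l))
    (@polyC _)) => [d|j] /=; first by rewrite mmapC shearC.
  rewrite mmapX mmap1U rmorphB -mul_mpolyC rmorphM /= !shearX shearC.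
  rewrite /shear_var liftK unlift_none polyC0 add0r -!mul_polyC mulrA.
  by rewrite -polyCM -mpolyCM divfK // addrK.
rewrite unshearX -mul_mpolyC rmorphM /= shearC shearX /shear_var unlift_none.
by rewrite polyC0 add0r -mul_polyC mulrA -polyCM -mpolyCM mulVf // mul1r.
Qed.

Lemma meval_mmap (k : fieldType) (m n : nat) (h : 'I_m -> {mpoly k[n]}) p v :
  (mmap (@mpolyC n k) h p).@[v] = p.@[fun i => (h i).@[v]].
Proof.
apply: (@mpoly_rmorph_ext _ _ _ (meval v \o mmap (@mpolyC n k) h) 
  (meval (fun i => (h i).@[v]))) => [c|i] /=.
  by rewrite mmapC !mevalC.
by rewrite mmapX mmap1U mevalXU.
Qed.

Definition shear_pt (k : fieldType) (n : nat) (l : 'I_n.+1 -> k) (a : 'I_n -> k) (t : k) :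
    'I_n.+1 -> k :=
  fun i => (if unlift ord_max i is Some j then a j else 0) + l i * t.

Lemma shear_meval (k : fieldType) (n : nat) (l : 'I_n.+1 -> k) p a t :
  p.@[shear_pt l a t] = (map_poly (meval a) (shear l p)).[t].
Proof.
apply: (@mpoly_rmorph_ext _ _ _ (meval (shear_pt l a t))
  (horner_eval t \o map_poly (meval a) \o shear l)) => [c|i] /=.
  by rewrite shearC mevalC map_polyC /horner_eval hornerC /= mevalC.
rewrite shearX mevalXU /horner_eval rmorphD /= map_polyC map_polyZ map_polyX /=.
rewrite !hornerE /= mevalC /shear_pt; congr (_ + _).
by case: unlift => [j|]; rewrite ?mevalXU ?meval0.
Qed.

(** If p vanished everywhere, the nonconstant polynomial p * 'X + 1 would have no root. *)
Lemma closed_poly_nonroot (k : closedFieldType) (p : {poly k}) :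
  p != 0 -> exists x, p.[x] != 0.
Proof.
move=> pN0; apply/not_all_not_ex => p0.
have sz1 : size (p * 'X + 1) != 1%N.
  rewrite size_polyDl size_mulX // ?eqSS ?size_poly_eq0 //.
  by rewrite size_poly1 ltnS size_poly_gt0.
have /closed_rootP[x] := sz1; rewrite /root !hornerE.
by have /negP := p0 x; rewrite negbK => /eqP->; rewrite mul0r add0r oner_eq0.
Qed.

Lemma mpoly0E (R : nzRingType) (p : {mpoly R[0]}) : p = (p@_0%MM)%:MP.
Proof.
apply/mpolyP => m; have -> : m = 0%MM by apply/mnmP; case.
by rewrite mcoeffC eqxx mulr1.
Qed.

Lemma meval_nonroot (k : closedFieldType) (n : nat) (p : {mpoly k[n]}) :
  p != 0 -> exists a, p.@[a] != 0.
Proof.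
elim: n p => [|n IHn] p pN0.
  exists (fun=> 0); move: pN0; rewrite [p]mpoly0E mevalC.
  by apply: contraNneq => ->.
(* For this [l] the shear mixes no variables: it only views the last one as the variable of a
   univariate polynomial. *)
pose l (i : 'I_n.+1) : k := (i == ord_max)%:R.
have lN0 : l ord_max != 0 by rewrite /l eqxx oner_eq0.
have qN0 : shear l p != 0.
  by apply: contraNneq pN0 => q0; rewrite -[p](unshearK lN0) q0 rmorph0.
have /IHn[a qa] : lead_coef (shear l p) != 0 by rewrite lead_coef_eq0.
have : map_poly (meval a) (shear l p) != 0.
  apply: contraNneq qa => /(congr1 (fun q : {poly k} => q`_(size (shear l p)).-1)).
  by rewrite coef_map coef0 => /eqP.
by case/closed_poly_nonroot => t qt; exists (shear_pt l a t); rewrite shear_meval.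
Qed.

Lemma meval_inj (k : closedFieldType) (n : nat) (p q : {mpoly k[n]}) :
  (forall a, p.@[a] = q.@[a]) -> p = q.
Proof.
move=> pq; apply/eqP; rewrite -subr_eq0; apply/negPn/negP => /meval_nonroot[a].
by rewrite mevalB pq subrr eqxx.
Qed.

(** * Ideals, monic shears and elimination *)

Record is_ideal (R : comNzRingType) (J : R -> Prop) : Prop := IsIdeal {
  ideal0 : J 0;
  idealD : forall x y, J x -> J y -> J (x + y);
  idealM : forall a x, J x -> J (a * x)
}.

Lemma idealN (R : comNzRingType) (J : R -> Prop) x : is_ideal J -> J x -> J (- x).
Proof. by move=> Ji Jx; rewrite -mulN1r; apply: idealM. Qed.

Lemma idealB (R : comNzRingType) (J : R -> Prop) x y :
  is_ideal J -> J x -> J y -> J (x - y).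
Proof. by move=> Ji Jx Jy; apply: idealD => //; apply: idealN. Qed.

Lemma ideal_sum (R : comNzRingType) (J : R -> Prop) (I : Type) (r : seq I)
    (P : pred I) (F : I -> R) :
  is_ideal J -> (forall i, P i -> J (F i)) -> J (\sum_(i <- r | P i) F i).
Proof. by move=> Ji JF; apply: big_ind => //; [apply: ideal0 | apply: idealD]. Qed.

Lemma ideal_preim (R S : comNzRingType) (f : {rmorphism R -> S}) (J : S -> Prop) :
  is_ideal J -> is_ideal (fun x => J (f x)).
Proof.
move=> Ji; split=> [|x y Jx Jy|a x Jx]; first by rewrite rmorph0; apply: ideal0.
  by rewrite rmorphD; apply: idealD.
by rewrite rmorphM; apply: idealM.
Qed.

(** Here [d] is only a bound on the degree and [c] may vanish, so that sums need no discussion of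
    cancellation. *)
Definition top_coef (R : comNzRingType) (q : {poly R}) (d : nat) (c : R) : Prop :=
  (size q <= d.+1)%N /\ q`_d = c.

Lemma top_coefM (R : comNzRingType) (q1 q2 : {poly R}) d1 d2 c1 c2 :
  top_coef q1 d1 c1 -> top_coef q2 d2 c2 -> top_coef (q1 * q2) (d1 + d2) (c1 * c2).
Proof.
move=> [s1 <-] [s2 <-]; split.
  apply: leq_trans (size_polyMleq _ _) _.
  by move: (leq_add s1 s2); rewrite addSn addnS; case: (_ + _)%N.
have lt1 : (d1 < (d1 + d2).+1)%N by rewrite ltnS leq_addr.
rewrite coefM (bigD1 (Ordinal lt1)) //= addKn big1 ?addr0 // => i neq_i.
have [le_i|lt_i] := leqP i d1; last by rewrite nth_default ?mul0r // (leq_trans s1).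
rewrite [q2`__]nth_default ?mulr0 //; apply: leq_trans s2 _.
have lt_i : (i < d1)%N by rewrite ltn_neqAle le_i andbT -(inj_eq val_inj) in neq_i *.
by rewrite ltn_subRL ltn_add2r.
Qed.

Lemma top_coef_prod (R : comNzRingType) (I : Type) (r : seq I)
    (F : I -> {poly R}) (d : I -> nat) (c : I -> R) :
  (forall i, top_coef (F i) (d i) (c i)) ->
  top_coef (\prod_(i <- r) F i) (\sum_(i <- r) d i) (\prod_(i <- r) c i).
Proof.
move=> Fdc; elim: r => [|i r IHr]; last by rewrite !big_cons; apply: top_coefM.
by rewrite !big_nil; split; rewrite ?size_poly1 ?coef1.
Qed.

Lemma top_coefX (R : comNzRingType) (q : {poly R}) d c m :
  top_coef q d c -> top_coef (q ^+ m) (d * m) (c ^+ m).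
Proof.
move=> qdc; elim: m => [|m IHm]; last by rewrite !exprS mulnS; apply: top_coefM.
by rewrite muln0 !expr0; split; rewrite ?size_poly1 ?coef1.
Qed.

Lemma top_coef_sum (R : comNzRingType) (I : eqType) (r : seq I)
    (F : I -> {poly R}) (d : nat) (c : I -> R) :
  {in r, forall i, top_coef (F i) d (c i)} ->
  top_coef (\sum_(i <- r) F i) d (\sum_(i <- r) c i).
Proof.
move=> Fdc; rewrite !big_seq; split.
  by apply: (big_ind (fun q : {poly R} => (size q <= d.+1)%N)) => [|p q|i /Fdc[]//];
    rewrite ?size_poly0 // => sp sq; rewrite (leq_trans (size_polyD _ _)) // geq_max sp.
by rewrite coef_sum; apply: eq_bigr => i /Fdc[].
Qed.

Lemma top_coef_shearX (k : fieldType) (n : nat) (l : 'I_n.+1 -> k) m :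
  top_coef (shear l 'X_[m]) (mdeg m) (\prod_i l i ^+ m i)%:MP.
Proof.
rewrite mpolyXE_id !rmorph_prod mdegE; apply: top_coef_prod => i.
rewrite !rmorphXn -[X in top_coef _ X _]mul1n /= shearX; apply: top_coefX.
rewrite /shear_var; split.
  by apply: leq_trans (size_polyD _ _) _; rewrite geq_max (leq_trans (size_polyC_leq1 _)) //
    (leq_trans (size_scale_leq _ _)) // size_polyX.
by rewrite coefD coefC coefZ coefX add0r mulr1.
Qed.

Lemma shear_monic (k : closedFieldType) (n : nat) (p : {mpoly k[n.+1]}) :
  p != 0 -> exists l : 'I_n.+1 -> k, exists2 c : k,
    (l ord_max != 0) && (c != 0) & shear l (c *: p) \is monic.
Proof.
move=> pN0; pose d := mdeg (mlead p).
(* [r] is the homogeneous part of top degree; its value at [l] is the coefficient of 'X^d in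
   [shear l p]. *)
pose r : {mpoly k[n.+1]} := \sum_(m <- msupp p | mdeg m == d) p@_m *: 'X_[m].
have rN0 : r != 0.
  apply/eqP => /(congr1 (mcoeff (mlead p))); rewrite mcoeff0 raddf_sum /=.
  rewrite big_mkcond (bigD1_seq (mlead p)) ?mlead_supp ?msupp_uniq //= eqxx.
  rewrite mcoeffZ mcoeffX eqxx mulr1 big1 ?addr0 => [/eqP|m neqm].
    by rewrite mleadc_eq0 (negbTE pN0).
  by case: ifP; rewrite // mcoeffZ mcoeffX (negbTE neqm) mulr0.
(* The factor 'X_ord_max makes the same [l] satisfy [l ord_max != 0], which makes the shear
   invertible. *)
have /meval_nonroot[l] : r * 'X_ord_max != 0.
  rewrite mulf_neq0 // -msize_poly_eq0 msizeX //.
rewrite mevalM mevalXU mulf_eq0 negb_or => /andP[rl lN0].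
exists l, (r.@[l])^-1; first by rewrite lN0 invr_neq0.
have [sz cf] : top_coef (shear l p) d (r.@[l])%:MP.
  have -> : r.@[l]%:MP = \sum_(m <- msupp p)
      (if mdeg m == d then p@_m * \prod_i l i ^+ m i else 0)%:MP :> {mpoly k[n]}.
    rewrite [r.@[l]]raddf_sum raddf_sum big_mkcond; apply: eq_bigr => m _ /=.
    by case: eqP => _; rewrite ?mpolyC0 // mevalZ mevalX.
  rewrite {1}(mpolyE p) raddf_sum; apply: top_coef_sum => m pm /=.
  have [szm cfm] := top_coef_shearX l m; rewrite -mul_mpolyC rmorphM /= shearC.
  have [md|neq_md] := eqVneq (mdeg m) d.
    by rewrite md in szm cfm; split; rewrite ?coefCM ?cfm ?mpolyCM // mul_polyC
      (leq_trans (size_scale_leq _ _)).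
  have lt_md : (mdeg m < d)%N.
    by rewrite ltn_neqAle neq_md; have := msize_mdeg_lt pm; rewrite -mlead_deg.
  have szm' : (size ((p@_m)%:MP%:P * shear l 'X_[m])%R <= d)%N.
    by rewrite mul_polyC (leq_trans (size_scale_leq _ _)) // (leq_trans szm).
  by split; [apply: leq_trans szm' _ | rewrite nth_default // mpolyC0].
have szE : size (shear l p) = d.+1.
  apply/eqP; rewrite eqn_leq sz ltnNge; apply/negP => /(nth_default 0).
  by rewrite cf => /eqP; rewrite mpolyC_eq0 (negbTE rl).
rewrite -mul_mpolyC rmorphM /= shearC monicE lead_coefM lead_coefC.
by rewrite /lead_coef szE /= cf -mpolyCM mulVf.
Qed.

Definition mpoly_ideal_zero (k : fieldType) (n : nat) (J : {mpoly k[n]} -> Prop)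
  (a : 'I_n -> k) : Prop := forall p, J p -> p.@[a] = 0.

(* The determinant of multiplication by q on the free module of polynomials
   modulo p lies in J, and it takes the value 1 at a if q specializes to 1. *)
Lemma elimination_proper (k : fieldType) (n : nat) (J : {poly {mpoly k[n]}} -> Prop)
    (p : {poly {mpoly k[n]}}) (a : 'I_n -> k) :
  is_ideal J -> p \is monic -> J p -> (forall b, J b%:P -> b.@[a] = 0) ->
  forall q, J q -> map_poly (meval a) q <> 1.
Proof.
move=> Ji pm Jp Ja q Jq q1.
have no1 : ~ J 1 by move=> /Ja; rewrite meval1 => /eqP; rewrite oner_eq0.
have [d sp] : exists d, size p = d.+2.
  case sp: (size p) => [|[|d]]; last by exists d.
    by move: pm; rewrite monicE /lead_coef sp nth_default ?sp // eq_sym oner_eq0.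
  case: no1; have -> : 1 = p by rewrite [p]size1_polyC ?sp //;
    move/monicP: pm; rewrite /lead_coef sp => ->.
  exact: Jp.
pose rem (i : nat) := rmodp ('X^i * q) p.
pose M : 'M[{mpoly k[n]}]_d.+1 := \matrix_(i, j) (rem i)`_j.
have rem_size i : (size (rem i) <= d.+1)%N.
  by rewrite -ltnS -sp ltn_rmodp // monic_neq0.
have MX : map_mx polyC M *m \col_(j < d.+1) 'X^j = \col_(i < d.+1) rem i.
  apply/colP => i; rewrite !mxE -[RHS]coefK poly_def.
  rewrite (big_ord_widen _ (fun j => (rem i)`_j *: 'X^j) (rem_size i)).
  rewrite [RHS]big_mkcond; apply: eq_bigr => j _; rewrite !mxE mul_polyC.
  by case: ltnP => // le_j; rewrite nth_default // scale0r.
have Jrem i : J (rem i).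
  have -> : rem i = 'X^i * q - rdivp ('X^i * q) p * p.
    by rewrite {1}[_ * q](rdivp_eq pm) addrC addKr.
  by apply: idealB => //; apply: idealM.
(* Cramer's rule: the adjugate turns [MX] into [\det M] times the column of powers of 'X, whose
   entry 0 is [\det M] itself. *)
have JM : J (\det M)%:P.
  have -> : (\det M)%:P = \sum_j (\adj (map_mx polyC M)) 0 j * rem j.
    have /matrixP/(_ 0 0) := congr1 (mulmx (\adj (map_mx polyC M))) MX.
    rewrite mulmxA mul_adj_mx -scalemx1 -scalemxAl mul1mx !mxE mulr1 det_map_mx => ->.
    by apply: eq_bigr => j _; rewrite !mxE.
  by apply: ideal_sum => // j _; apply: idealM.
suff aM : map_mx (meval a) M = 1%:M.
  by have := Ja _ JM; rewrite -det_map_mx aM det1 => /eqP; rewrite oner_eq0.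
have pam : map_poly (meval a) p \is monic by apply: monic_map.
have spa : size (map_poly (meval a) p) = d.+2.
  by rewrite size_map_poly_id0 // (monicP pm) meval1 oner_neq0.
apply/matrixP => i j; rewrite !mxE.
have -> : ((rem i)`_j).@[a] = (map_poly (meval a) (rem i))`_j by rewrite coef_map.
suff -> : map_poly (meval a) (rem i) = 'X^i by rewrite coefXn eq_sym.
have := congr1 (map_poly (meval a)) (rdivp_eq pm ('X^i * q)).
rewrite rmorphM rmorphD rmorphM /= q1 mulr1 map_polyXn -/(rem i).
move/(congr1 (fun u => rmodp u (map_poly (meval a) p))).
rewrite rmodp_addl_mul_small // ?spa ?ltnS ?(leq_trans (size_poly _ _)) ?rem_size //.
by move=> <-; rewrite rmodp_small // size_polyXn spa ltnS.
Qed.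

(** * Hilbert's Nullstellensatz *)

(** Specializing J at [a] gives an ideal of a univariate polynomial ring, hence a principal one. If
    its generator were a unit, some element of J would specialize to 1, against
    [elimination_proper]; so the generator has a root [t]. *)
Lemma elimination_zero (k : closedFieldType) (n : nat) (J : {poly {mpoly k[n]}} -> Prop)
    (p : {poly {mpoly k[n]}}) (a : 'I_n -> k) :
  is_ideal J -> p \is monic -> J p -> (forall b, J b%:P -> b.@[a] = 0) ->
  exists t, forall q, J q -> (map_poly (meval a) q).[t] = 0.
Proof.
move=> Ji pm Jp Ja; pose ev := map_poly (meval a).
pose lift_poly (q : {poly k}) : {poly {mpoly k[n]}} := map_poly (@mpolyC n k) q.
have ev_lift q : ev (lift_poly q) = q.
  by apply/polyP => i; rewrite !coef_map /= mevalC.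
(* A generator is reached by descent on the size: an element of J that it fails to divide leaves a
   smaller nonzero remainder. [lift_poly] realizes the quotient inside the larger ring. *)
have [g [Jg gN0 g_gen]] : exists g, [/\ J g, ev g != 0 & forall q, J q -> ev g %| ev q].
  suff H N q0 : J q0 -> ev q0 != 0 -> (size (ev q0) <= N)%N ->
      exists g, [/\ J g, ev g != 0 & forall q, J q -> ev g %| ev q].
    by apply: (H _ p); rewrite ?monic_neq0 ?monic_map.
  elim: N q0 => [|N IHN] q0 Jq0 q0N0.
    by rewrite leqn0 size_poly_eq0 (negbTE q0N0).
  move=> le_q0N.
  have [q0_gen|] := classic (forall q, J q -> ev q0 %| ev q); first by exists q0.
  move=> not_gen; have [q not_q] := not_all_ex_not _ _ not_gen.
  have [Jq /negP ndiv] := imply_to_and _ _ not_q.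
  have evr : ev (q - lift_poly (ev q %/ ev q0) * q0) = ev q %% ev q0.
    by rewrite /ev rmorphB rmorphM /= -/ev ev_lift {1}[ev q](divp_eq _ (ev q0)) addrC addKr.
  apply: (IHN (q - lift_poly (ev q %/ ev q0) * q0)).
  - by apply: idealB => //; apply: idealM.
  - by rewrite evr; move: ndiv; rewrite /dvdp.
  - by rewrite evr -ltnS; apply: leq_trans le_q0N; rewrite ltn_modp.
have [sg|/closed_rootP[t gt]] := eqVneq (size (ev g)) 1%N; last first.
  by exists t => q /g_gen/dvdpP[h hE]; rewrite -/ev hE hornerM (rootP gt) mulr0.
have [c cN0 evg] := size_poly1P _ (introT eqP sg).
case: (@elimination_proper _ _ _ _ _ Ji pm Jp Ja (lift_poly c^-1%:P * g)).
  exact: idealM.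
by rewrite rmorphM /= -!/ev ev_lift evg -polyCM mulVf.
Qed.

(** Induction on n: after a shear J contains a monic polynomial, the elimination ideal [J''] has a
    zero by induction, and this zero extends to one of J. *)
Lemma weak_nullstellensatz (k : closedFieldType) (n : nat) (J : {mpoly k[n]} -> Prop) :
  is_ideal J -> ~ J 1 -> exists a, mpoly_ideal_zero J a.
Proof.
elim: n J => [|n IHn] J Ji J1.
  exists (fun=> 0) => p Jp; rewrite [p]mpoly0E mevalC.
  have [//|p0] := eqVneq (p@_0) 0; case: J1.
  rewrite -mpolyC1 -(mulVf p0) mpolyCM -mpoly0E; exact: idealM.
have [[p [Jp pN0]]|J0] := classic (exists p, J p /\ p != 0); last first.
  exists (fun=> 0) => p Jp; have [->|pN0] := eqVneq p 0; first exact: meval0.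
  by case: J0; exists p.
have [l [c /andP[lN0 cN0] pm]] := shear_monic pN0.
pose J' q := J (unshear l q).
have J'i : is_ideal J' by apply: ideal_preim (Ji).
pose J'' b := J' b%:P.
have J''i : is_ideal J'' by apply: ideal_preim (J'i).
have [|a J''a] := IHn J'' J''i.
  by rewrite /J'' /J' !rmorph1.
have Jcp : J' (shear l (c *: p)).
  by rewrite /J' unshearK // -mul_mpolyC; apply: idealM.
have [t J't] := elimination_zero J'i pm Jcp J''a.
exists (shear_pt l a t) => q Jq; rewrite shear_meval; apply: J't.
by rewrite /J' unshearK.
Qed.

Definition mpoly_incl (k : fieldType) (n : nat) (p : {mpoly k[n]}) : {mpoly k[n.+1]} :=
  mmap (@mpolyC n.+1 k) (fun j => 'X_(lift ord_max j)) p.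

HB.instance Definition _ (k : fieldType) (n : nat) :=
  GRing.RMorphism.copy (@mpoly_incl k n)
    (mmap (@mpolyC n.+1 k) (fun j => 'X_(lift ord_max j))).

Local Notation "x %:F" := (tofrac x).

(* Rabinowitsch's trick: the last variable becomes 1/p. *)
Definition eval_inv_var (k : fieldType) (n : nat) (p : {mpoly k[n]}) (i : 'I_n.+1) :
    {fraction {mpoly k[n]}} :=
  if unlift ord_max i is Some j then ('X_j)%:F else p%:F^-1.

Definition eval_inv (k : fieldType) (n : nat) (p : {mpoly k[n]}) (q : {mpoly k[n.+1]}) :
    {fraction {mpoly k[n]}} :=
  mmap (@tofrac {mpoly k[n]} \o @mpolyC n k) (eval_inv_var p) q.

HB.instance Definition _ (k : fieldType) (n : nat) (p : {mpoly k[n]}) :=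
  GRing.RMorphism.copy (eval_inv p)
    (mmap (@tofrac {mpoly k[n]} \o @mpolyC n k) (eval_inv_var p)).

Lemma eval_inv_incl (k : fieldType) (n : nat) (p q : {mpoly k[n]}) :
  eval_inv p (mpoly_incl q) = q%:F.
Proof.
apply: (@mpoly_rmorph_ext _ _ _ (eval_inv p \o @mpoly_incl k n) (@tofrac _)) => [c|i] /=.
  by rewrite /mpoly_incl mmapC /eval_inv mmapC.
by rewrite /mpoly_incl mmapX mmap1U /eval_inv mmapX mmap1U /eval_inv_var liftK.
Qed.

Lemma eval_inv_denom (k : fieldType) (n : nat) (p : {mpoly k[n]}) q : p != 0 ->
  exists N a, eval_inv p q * p%:F ^+ N = a%:F.
Proof.
move=> pN0; have pF : p%:F != 0 by rewrite tofrac_eq0.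
elim/mpolyind: q => [|c m q mq cN0 [N [a qE]]].
  by exists 0%N, 0; rewrite rmorph0 mul0r.
have [M [b mE]] : exists M b, eval_inv p (c *: 'X_[m]) * p%:F ^+ M = b%:F.
  rewrite -mul_mpolyC rmorphM /= /eval_inv mmapC mmapX /=.
  suff [M [b E]] : exists M b, mmap1 (eval_inv_var p) m * p%:F ^+ M = b%:F.
    by exists M, (c%:MP * b); rewrite -mulrA E -rmorphM.
  rewrite /mmap1 (bigD1 ord_max) //= /eval_inv_var unlift_none.
  exists (m ord_max), (\prod_(i < n.+1 | i != ord_max)
     (if unlift ord_max i is Some j then 'X_j else 0) ^+ m i).
  rewrite mulrAC -exprMn mulVf // expr1n mul1r rmorph_prod; apply: eq_bigr => i.
  by case: unliftP => [j ->|->]; rewrite ?eqxx // rmorphXn.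
exists (M + N)%N, (b * p ^+ N + a * p ^+ M).
by rewrite [eval_inv _ _]rmorphD tofracD !tofracM !tofracXn /= -mE -qE exprD; ring.
Qed.

Lemma nullstellensatz (k : closedFieldType) (n : nat) (J : {mpoly k[n]} -> Prop) p :
  is_ideal J -> (forall a, mpoly_ideal_zero J a -> p.@[a] = 0) ->
  exists N, J (p ^+ N).
Proof.
move=> Ji pJ; have [->|pN0] := eqVneq p 0.
  by exists 1%N; rewrite expr1; apply: ideal0.
have pF : p%:F != 0 by rewrite tofrac_eq0.
(* [K] consists of the polynomials whose value at 1/p in the last variable lies in the extension of
   J to the ring with p inverted. *)
pose K q := exists N a, J a /\ eval_inv p q * p%:F ^+ N = a%:F.
have Ki : is_ideal K.
  split=> [|x y [N [a [Ja xE]]] [M [b [Jb yE]]]|x y [N [a [Ja yE]]]].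
  - by exists 0%N, 0; split; [apply: ideal0 | rewrite rmorph0 mul0r].
  - exists (N + M)%N, (p ^+ M * a + p ^+ N * b).
    split; first by apply: idealD => //; apply: idealM.
    rewrite !rmorphD !rmorphM !rmorphXn /= -xE -yE exprD mulrDl.
    by ring.
  - have [M [b xE]] := eval_inv_denom x pN0.
    exists (M + N)%N, (b * a); split; first exact: idealM.
    by rewrite !rmorphM /= -xE -yE exprD mulrACA.
have [[N [a [Ja]]]|K1] := classic (K 1).
  by rewrite rmorph1 mul1r -rmorphXn => /eqP; rewrite tofrac_eq => /eqP pE; exists N; rewrite pE.
have [b Kb] := weak_nullstellensatz Ki K1.
have bp q : (mpoly_incl q).@[b] = q.@[fun j => b (lift ord_max j)].
  by rewrite meval_mmap; apply: meval_eq => j; rewrite mevalXU.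
(* This polynomial maps to 0, so it lies in [K]; but [b] restricts to a zero of J, where p vanishes,
   which leaves -1 = 0. *)
have : (mpoly_incl p * 'X_ord_max - 1).@[b] = 0.
  apply: Kb; exists 0%N, 0; split; first exact: ideal0.
  rewrite rmorphB rmorphM rmorph1 /= eval_inv_incl /eval_inv mmapX mmap1U /eval_inv_var unlift_none.
  by rewrite divff // subrr mul0r rmorph0.
rewrite mevalB mevalM meval1 bp pJ ?mul0r ?sub0r => [/eqP|q Jq].
  by rewrite oppr_eq0 oner_eq0.
rewrite -bp; apply: Kb; exists 0%N, q; split=> //.
by rewrite eval_inv_incl mulr1.
Qed.

(** * Dimension and codimension *)

Lemma msizeM_leq (R : idomainType) (n : nat) (p q : {mpoly R[n]}) d e :
  (msize p <= d.+1)%N -> (msize q <= e.+1)%N -> (msize (p * q) <= (d + e).+1)%N.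
Proof.
have [->|pN0] := eqVneq p 0; first by rewrite mul0r msize0.
have [->|qN0] := eqVneq q 0; first by rewrite mulr0 msize0.
move=> sp sq; rewrite msizeM //.
by move: (leq_add sp sq); rewrite addSn addnS; case: (_ + _)%N.
Qed.

Lemma msizeX_leq (R : idomainType) (n : nat) (p : {mpoly R[n]}) d m :
  (msize p <= d.+1)%N -> (msize (p ^+ m) <= (m * d).+1)%N.
Proof.
move=> sp; elim: m => [|m IHm]; first by rewrite expr0 msize1.
by rewrite exprS mulSn; apply: msizeM_leq.
Qed.

Lemma msize_prod_leq (R : idomainType) (n N : nat) (F : 'I_N -> {mpoly R[n]}) d :
  (forall i, msize (F i) <= d.+1)%N -> (msize (\prod_i F i) <= (N * d).+1)%N.
Proof.
elim: N F => [|N IHN] F sF; first by rewrite big_ord0 msize1.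
by rewrite big_ord_recl mulSn; apply: msizeM_leq => //; apply: IHN.
Qed.

(* The monomials with exponents < M in N variables outnumber the monomials of
   degree O(M) in n < N variables. *)
Lemma mpoly_embedding_leq (k : fieldType) (N n : nat)
    (f : {rmorphism {mpoly k[N]} -> {mpoly k[n]}}) :
  (forall c, f c%:MP = c%:MP) -> (forall p, f p = 0 -> p = 0) -> (N <= n)%N.
Proof.
move=> fC f_inj; rewrite leqNgt; apply/negP => lt_nN.
pose d := (\sum_i msize (f 'X_i))%N.
have fX i : (msize (f 'X_i) <= d.+1)%N.
  by rewrite leqW // /d (bigD1 i) //= leq_addr.
(* Images of the chosen monomials have degree below D <= (N d + 1) M, and M > (N d + 1)^n gives D^n
   < M^(n+1) <= M^N: more rows than columns in [B]. *)
pose M := ((N * d).+1 ^ n).+1; pose D := (N * (M * d)).+1.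
pose rI := {ffun 'I_N -> 'I_M}; pose cI := {ffun 'I_n -> 'I_D}.
have lt_card : (#|{: cI}| < #|{: rI}|)%N.
  rewrite !card_ffun !card_ord.
  apply: (@leq_ltn_trans ((N * d).+1 ^ n * M ^ n)).
    have leD : (D <= (N * d).+1 * M)%N.
      by rewrite /D mulSn mulnCA [(M * _)%N]mulnC -[X in (X <= _)%N]add1n leq_add.
    by rewrite -expnMn; case: (n) => [//|n']; rewrite leq_exp2r.
  apply: (@leq_trans (M ^ n.+1)); last by rewrite leq_pexp2l.
  by rewrite expnS ltn_pmul2r // expn_gt0.
pose rmon (e : rI) := [multinom (e i : nat) | i < N].
pose cmon (e : cI) := [multinom (e i : nat) | i < n].
pose B := \matrix_(i < #|{: rI}|, j < #|{: cI}|)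
  (f 'X_[rmon (enum_val i)])@_(cmon (enum_val j)).
have /rowV0Pn[v /sub_kermxP vB vN0] : kermx B != 0.
  rewrite kermx_eq0 /row_free; apply/eqP => rkB.
  by have := rank_leq_col B; rewrite rkB leqNgt lt_card.
pose p : {mpoly k[N]} := \sum_i v 0 i *: 'X_[rmon (enum_val i)].
case/eqP: vN0; apply/rowP => i; rewrite mxE.
have rmon_inj : injective rmon.
  by move=> e1 e2 /mnmP e12; apply/ffunP => j; apply: val_inj; have := e12 j; rewrite !mnmE.
have -> : v 0 i = p@_(rmon (enum_val i)).
  rewrite raddf_sum (bigD1 i) //= mcoeffZ mcoeffX eqxx mulr1 big1 ?addr0 // => j neq_ji.
  by rewrite mcoeffZ mcoeffX (inj_eq rmon_inj) (inj_eq enum_val_inj) (negbTE neq_ji) mulr0.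
suff -> : p = 0 by rewrite mcoeff0.
apply: f_inj; apply/mpolyP => m; rewrite mcoeff0.
have fp : f p = \sum_i v 0 i *: f 'X_[rmon (enum_val i)].
  by rewrite raddf_sum; apply: eq_bigr => j _ /=; rewrite -!mul_mpolyC rmorphM fC.
have [lt_m|le_m] := ltnP (mdeg m) D; last first.
  rewrite fp raddf_sum big1 // => j _; rewrite /= mcoeffZ.
  rewrite [_@_m](memN_msupp_eq0) ?mulr0 //; apply: msize_mdeg_ge.
  apply: leq_trans le_m; rewrite mpolyXE_id rmorph_prod; apply: msize_prod_leq => s.
  rewrite rmorphXn (leq_trans (msizeX_leq _ (fX s))) // ltnS leq_mul2r mnmE.
  by rewrite ltnW ?orbT //.
have m_ord s : (m s < D)%N by apply: leq_ltn_trans lt_m; rewrite mdegE (bigD1 s) //= leq_addr.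
pose e : cI := [ffun s => Ordinal (m_ord s)].
have -> : m = cmon e by apply/mnmP => s; rewrite mnmE ffunE.
have /rowP/(_ (enum_rank e)) := vB; rewrite !mxE => <-.
rewrite fp raddf_sum; apply: eq_bigr => j _.
by rewrite /= mcoeffZ !mxE enum_rankK.
Qed.

(** The nonzero elements of the domain B have a multiplicatively closed image, so an ideal maximal
    among those containing I and avoiding that image is prime. *)
Lemma exists_prime_avoiding (A B : idomainType) (f : {rmorphism B -> A}) (I : A -> Prop) :
  is_ideal I -> (forall c, I (f c) -> c = 0) ->
  exists P : A -> Prop, [/\ is_ideal P, forall x, I x -> P x,
    forall c, P (f c) -> c = 0 & forall x y, P (x * y) -> P x \/ P y].
Proof.
move=> Ii If.
(* Stability under adding elements of I replaces containment of I, so that the empty union, coming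
   from the empty chain, is also [good]; [P0] then excludes the empty set. *)
pose good (P : A -> Prop) := [/\ forall x y, P x -> P y -> P (x + y),
  forall a x, P x -> P (a * x), forall x y, P x -> I y -> P (x + y)
  & forall c, P (f c) -> c = 0].
have [F goodF totF|P [[PD PM PI Pf] Pmax]] := @classical_sets.Zorn_bigcup A good.
  split=> [x y [X FX Xx] [Y FY Yy]|a x [X FX Xx]|x y [X FX Xx] Iy|c [X FX Xc]].
  - have [_ XM _ _] := goodF _ FX.
    have [sXY|sYX] := totF _ _ FX FY.
      by exists Y => //=; have [YD _ _ _] := goodF _ FY; apply: YD => //; apply: sXY.
    by exists X => //=; have [XD _ _ _] := goodF _ FX; apply: XD => //; apply: sYX.
  - by exists X => //=; have [_ XM _ _] := goodF _ FX; apply: XM.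
  - by exists X => //=; have [_ _ XI _] := goodF _ FX; apply: XI.
  - by have [_ _ _] := goodF _ FX; apply.
have P0 : P 0.
  apply: NNPP => nP0; apply: (Pmax I).
    split=> [x Px|sIP]; last by apply: nP0; apply: (sIP 0 (ideal0 Ii)).
    by case: nP0; rewrite -(mul0r x); apply: PM.
  by split=> // *; [apply: idealD | apply: idealM | apply: idealD].
have IP x : I x -> P x by move=> Ix; rewrite -(add0r x); apply: PI.
(* By maximality the ideal generated by P and x meets the image of the nonzero elements. *)
have avoid x : ~ P x -> exists c r p, [/\ c != 0, P p & f c = p + r * x].
  move=> nPx; apply: NNPP => no.
  pose Q y := exists r p, P p /\ y = p + r * x.
  apply: (Pmax Q).
    split=> [y Py|sQP]; first by exists 0, y; rewrite mul0r addr0.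
    by apply: nPx; apply: (sQP x); exists 1, 0; rewrite mul1r add0r.
  split.
  - move=> _ _ [r [p [Pp ->]]] [s [q [Pq ->]]]; exists (r + s), (p + q).
    by split; [apply: PD | ring].
  - by move=> a _ [r [p [Pp ->]]]; exists (a * r), (a * p); split; [apply: PM | ring].
  - move=> _ y [r [p [Pp ->]]] Iy; exists r, (p + y); split; last by ring.
    exact: PI.
  - move=> c [r [p [Pp fc]]]; apply: NNPP => /eqP cN0; apply: no.
    by exists c, r, p.
exists P; split=> // x y Pxy; apply: NNPP => nPxy; have [nPx nPy] := not_or_and _ _ nPxy.
have [c [r [p [cN0 Pp fc]]]] := avoid x nPx.
have [d [s [q [dN0 Pq fd]]]] := avoid y nPy.
suff : c * d = 0 by apply/eqP; rewrite mulf_neq0.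
apply: Pf; rewrite rmorphM fc fd.
have -> : (p + r * x) * (q + s * y) = (q + s * y) * p + (r * x * q + (r * s) * (x * y)).
  by ring.
by apply: (PD _ _ (PM _ _ Pp)); apply: PD; apply: (PM).
Qed.

Definition vanishing (k : fieldType) (U : vectType k) (Y : U -> Prop)
  (p : {mpoly k[dim U]}) : Prop := forall u, Y u -> peval p u = 0.

Lemma vanishing_ideal (k : fieldType) (U : vectType k) (Y : U -> Prop) :
  is_ideal (vanishing Y).
Proof.
split=> [u _|p q Yp Yq u Yu|p q Yq u Yu]; rewrite /peval ?meval0 //.
  by rewrite mevalD -!/(peval _ u) Yp ?Yq ?addr0.
by rewrite mevalM -!/(peval _ u) Yq ?mulr0.
Qed.

Lemma peval_pt (k : fieldType) (U : vectType k) (p : {mpoly k[dim U]}) (a : 'I_(dim U) -> k) :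
  peval p (r2v (\row_i a i) : U) = p.@[a].
Proof. by rewrite /peval r2vK; apply: meval_eq => i; rewrite mxE. Qed.

Lemma irreducible_vanishing_prime (k : fieldType) (U : vectType k) (Y : U -> Prop) p q :
  zirreducible Y -> vanishing Y (p * q) -> vanishing Y p \/ vanishing Y q.
Proof.
move=> [_ Yirr] Ypq; apply: Yirr => [||u Yu].
- by exists (fun r => r = p) => u; split=> [pu _ ->//|->].
- by exists (fun r => r = q) => u; split=> [qu _ ->//|->].
- by have /eqP := Ypq u Yu; rewrite /peval mevalM mulf_eq0 => /orP[]/eqP; [left|right].
Qed.

Lemma closed_separate (k : fieldType) (U : vectType k) (Y : U -> Prop) u :
  zclosed Y -> ~ Y u -> exists2 p, vanishing Y p & peval p u != 0.
Proof.
move=> [S YS] nYu; apply: NNPP => no; apply/nYu/YS => p Sp.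
apply: NNPP => /eqP pu; apply: no; exists p => // v /YS; exact.
Qed.

(** The polynomials [f 'X_i] are algebraically independent as functions on Y, so N is a lower bound
    for the dimension of Y. *)
Definition indep_on (k : fieldType) (U : vectType k) (Y : U -> Prop) (N : nat)
    (f : {mpoly k[N]} -> {mpoly k[dim U]}) : Prop :=
  (forall c, f c%:MP = c%:MP) /\ (forall p, vanishing Y (f p) -> p = 0).

Lemma indep_on_component (k : closedFieldType) (U : vectType k) (Z : U -> Prop)
    (N : nat) (f : {rmorphism {mpoly k[N]} -> {mpoly k[dim U]}}) :
  zclosed Z -> indep_on Z f ->
  exists Y, [/\ zclosed Y, zirreducible Y, forall u, Y u -> Z u & indep_on Y f].
Proof.
move=> Zc [fC fZ].
have [P [Pi ZP fP Pprime]] := exists_prime_avoiding (vanishing_ideal Z) fZ.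
pose Y (u : U) := forall p, P p -> peval p u = 0.
(* The ideal of Y is exactly P: the Nullstellensatz gives a power in P, and P is prime. *)
have YP p : vanishing Y p -> P p.
  move=> Yp; have [a Pa|N' PpN] := @nullstellensatz _ _ P p Pi.
    by rewrite -peval_pt; apply: Yp => q Pq; rewrite peval_pt; apply: Pa.
  elim: N' PpN => [|N' IHN]; first by rewrite -[p]mulr1; apply: idealM.
  by rewrite exprS => /Pprime[].
have nP1 : ~ P 1.
  move=> P1; have /eqP : 1 = 0 :> {mpoly k[N]} by apply: fP; rewrite rmorph1.
  by rewrite oner_eq0.
exists Y; split.
- by exists P.
- split.
    by apply: NNPP => noY; apply: nP1; apply: YP => u Yu; case: noY; exists u.
  have outside A : zclosed A -> ~ (forall u, Y u -> A u) -> exists2 p, vanishing A p & ~ P p.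
    move=> Ac nA; have [u nu] := not_all_ex_not _ _ nA; have [Yu nAu] := imply_to_and _ _ nu.
    have [p Ap pu] := closed_separate Ac nAu; exists p => // Pp.
    by rewrite (Yu p Pp) eqxx in pu.
  move=> A B Ac Bc YAB; apply: NNPP => nAB; have [nA nB] := not_or_and _ _ nAB.
  have [p Ap nPp] := outside A Ac nA; have [q Bq nPq] := outside B Bc nB.
  suff /YP/Pprime[] : vanishing Y (p * q) by [].
  move=> u Yu; rewrite /peval mevalM -!/(peval _ u).
  by case: (YAB u Yu) => [/Ap->|/Bq->]; rewrite ?mul0r ?mulr0.
- move=> u Yu; apply: NNPP => nZu.
  have [p Zp pu] := closed_separate Zc nZu.
  by rewrite (Yu p (ZP p Zp)) eqxx in pu.
- by split=> // p /YP/fP.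
Qed.

(** A polynomial [h] vanishing on Y but not on Y' is the new independent function: restricting a
    relation in [h] to Y kills its constant coefficient, and irreducibility of Y' allows division by
    [h]. *)
Lemma indep_on_extend (k : fieldType) (U : vectType k) (Y Y' : U -> Prop)
    (N : nat) (f : {rmorphism {mpoly k[N]} -> {mpoly k[dim U]}}) u :
  indep_on Y f -> zclosed Y -> zirreducible Y' -> (forall u, Y u -> Y' u) ->
  Y' u -> ~ Y u ->
  exists f' : {rmorphism {mpoly k[N.+1]} -> {mpoly k[dim U]}}, indep_on Y' f'.
Proof.
move=> [fC fY] Yc Y'irr sYY' Y'u nYu.
have [h Yh hu] := closed_separate Yc nYu.
have nY'h : ~ vanishing Y' h by move/(_ u Y'u)/eqP; rewrite (negbTE hu).
pose l (i : 'I_N.+1) : k := (i == ord_max)%:R.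
have lN0 : l ord_max != 0 by rewrite /l eqxx oner_eq0.
exists (horner_eval h \o map_poly f \o shear l); split=> [c|p] /=.
  by rewrite shearC map_polyC /horner_eval hornerC /= fC.
rewrite -[RHS](rmorph0 (unshear l)) -[X in _ -> X = _](unshearK lN0) => pY'; congr unshear.
elim/poly_ind: (shear l p) pY' => // q b IHq.
rewrite /horner_eval rmorphD rmorphM /= map_polyX map_polyC hornerMXaddC /= => qY'.
have b0 : b = 0.
  apply: fY => v Yv; have := qY' v (sYY' v Yv); rewrite /peval mevalD mevalM.
  by rewrite -/(peval h v) Yh // mulr0 add0r.
move: qY'; rewrite b0 rmorph0 addr0 => /(irreducible_vanishing_prime Y'irr)[/IHq->|//].
by rewrite mul0r add0r.
Qed.

(** Climbing a chain of length d from a component on which [f] stays independent yields d + N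
    independent functions on the whole space. *)
Lemma codim_indep_leq (k : closedFieldType) (U : vectType k) (Z : U -> Prop) (d N : nat)
    (f : {rmorphism {mpoly k[N]} -> {mpoly k[dim U]}}) :
  zclosed Z -> codim_ge Z d -> indep_on Z f -> (d + N <= dim U)%N.
Proof.
move=> Zc Zd /(indep_on_component Zc)[Y [Yc Yirr sYZ fY]].
have [C [CY Cirr Cinc]] := Zd Y Yc Yirr sYZ.
have H i : (i <= d)%N ->
    exists f' : {rmorphism {mpoly k[i + N]} -> {mpoly k[dim U]}}, indep_on (C i) f'.
  elim: i => [_|i IHi lt_id].
    by exists f; case: fY => fC fY; split=> // p Cp; apply: fY => u /CY; apply: Cp.
  have [f' f'C] := IHi (ltnW lt_id).
  have [sC [u [Cu nCu]]] := Cinc _ lt_id.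
  apply: (indep_on_extend f'C _ _ sC Cu nCu); first by have [] := Cirr _ (ltnW lt_id).
  by have [] := Cirr _ lt_id.
have [f' [f'C f'inj]] := H d (leqnn d).
apply: (mpoly_embedding_leq f'C) => p fp; apply: f'inj => u _.
by rewrite fp /peval meval0.
Qed.

(** * Regular sequences from Noether normalization *)

(** Modulo a monic polynomial the quotient is a free R-module, so a nonzero scalar [b] is not a zero
    divisor there. *)
Lemma monic_dvd_scale (R : idomainType) (q u v : {poly R}) b :
  q \is monic -> b != 0 -> q * u = b *: v -> exists w, v = q * w.
Proof.
move=> qm bN0 quv; exists (rdivp v q).
have : rmodp (b *: v) q = 0 by rewrite -quv mulrC rmodp_mull.
rewrite rmodpZ // => /eqP; rewrite scale_poly_eq0 (negbTE bN0) => /eqP r0.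
by rewrite {1}(rdivp_eq qm v) r0 addr0 mulrC.
Qed.

(** Passing to remainders modulo [q] reduces the claim to the same claim for each coefficient, in
    R. *)
Lemma monic_scale_sum (R : idomainType) (q x u v : {poly R}) b c :
  q \is monic -> (forall y z : R, c * y = b * z -> exists w, y = b * w) ->
  c *: x = q * u + b *: v -> exists s t, x = q * s + b *: t.
Proof.
move=> qm cb xuv.
have cr : c *: rmodp x q = b *: rmodp v q.
  by rewrite -!rmodpZ // xuv rmodpD // [q * u]mulrC rmodp_mull // add0r.
have coefr i : exists w, (rmodp x q)`_i = b * w.
  by apply: (cb _ (rmodp v q)`_i); rewrite -!coefZ cr.
pose w i := sval (constructive_indefinite_description _ (coefr i)).
have wE i : (rmodp x q)`_i = b * w i by rewrite /w; case: constructive_indefinite_description.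
exists (rdivp x q), (\poly_(i < size (rmodp x q)) w i).
rewrite {1}(rdivp_eq qm x) mulrC; congr (_ + _); apply/polyP => i.
rewrite coefZ coef_poly; case: ltnP => [_|le_i]; first exact: wE.
by rewrite nth_default ?mulr0.
Qed.

(* Regularity of p1^N, p2^N, p3^N: p2^N is regular
   modulo p1^N, and p3^N is regular modulo both. *)
Definition strong_regular (R : comNzRingType) (p1 p2 p3 : R) : Prop :=
  [/\ p1 != 0,
      forall N u v, p1 ^+ N * u = p2 ^+ N * v -> exists w, v = p1 ^+ N * w
    & forall N x u v, p3 ^+ N * x = p1 ^+ N * u + p2 ^+ N * v ->
        exists s t, x = p1 ^+ N * s + p2 ^+ N * t].

(* Noether normalization: up to linear changes of coordinates, p1 is monic in
   the last variable, p2 is monic in the last but one and free of the last,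
   and p3 is free of both. *)
Lemma exists_strong_regular (k : closedFieldType) (n : nat) (J : {mpoly k[n]} -> Prop) :
  is_ideal J ->
  (forall N (f : {rmorphism {mpoly k[N]} -> {mpoly k[n]}}),
     (forall c, f c%:MP = c%:MP) -> (forall p, J (f p) -> p = 0) -> (3 + N <= n)%N) ->
  exists p1 p2 p3, [/\ J p1, J p2, J p3 & strong_regular p1 p2 p3].
Proof.
move=> Ji codimJ; have [J1|nJ1] := classic (J 1).
  exists 1, 1, 1; split=> //; split=> [|N u v|N x u v _]; first exact: oner_neq0.
    by exists v; rewrite expr1n mul1r.
  by exists x, 0; rewrite expr1n !mul1r addr0.
have dep N (f : {rmorphism {mpoly k[N]} -> {mpoly k[n]}}) :
    (forall c, f c%:MP = c%:MP) -> (n < 3 + N)%N -> exists2 p, p != 0 & J (f p).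
  move=> fC; rewrite ltnNge => /negP nle; apply: NNPP => no; apply: nle.
  apply: (codimJ _ f fC) => p Jp; apply/eqP/negPn/negP => pN0; apply: no; by exists p.
have n_gt2 : (2 < n)%N.
  rewrite ltnNge; apply/negP => le_n2.
  pose f := mmap (@mpolyC n k) (fun _ : 'I_0 => 0).
  have [|p pN0 Jfp] := dep 0%N f _ le_n2; first exact: mmapC.
  have fp : f p = (p@_0%MM)%:MP by rewrite [p in LHS]mpoly0E; apply: mmapC.
  have Jc : J (p@_0%MM)%:MP by rewrite -fp; apply: Jfp.
  rewrite [p]mpoly0E mpolyC_eq0 in pN0; case: nJ1.
  by rewrite -mpolyC1 -(mulVf pN0) mpolyCM; apply: idealM.
case: n J Ji codimJ nJ1 dep n_gt2 => [|[|m]] // J Ji _ _ dep _.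
(* The original n is now m + 2; [dep] is applied to subrings in m + 2, m + 1 and m variables. The
   last is the extreme case, as 3 + m exceeds m + 2 by one. *)
have [p pN0 Jp] : exists2 p, p != 0 & J p 
  by apply: (dep _ idfun) => //; rewrite ltnS leqW.
have [l [c /andP[lN0 cN0] q1m]] := shear_monic pN0; set q1 := shear l _ in q1m.
have [b bN0 Jb] : exists2 b, b != 0 & J (unshear l b%:P).
  apply: (dep _ (unshear l \o polyC)) => [d|]; last by rewrite ltnS leqnSn.
  by rewrite /= unshearP mmapC.
have [l' [c' /andP[l'N0 c'N0] q2m]] := shear_monic bN0; set q2 := shear l' _ in q2m.
have [e eN0 Je] : exists2 e, e != 0 & J (unshear l (unshear l' e%:P)%:P).
  apply: (dep _ (unshear l \o polyC \o unshear l' \o polyC)) => // d.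
  by rewrite /= !unshearP !mmapC.
pose b' := unshear l' q2; pose e' := unshear l' e%:P.
exists (unshear l q1), (unshear l b'%:P), (unshear l e'%:P).
have ZE (x : {mpoly k[m.+1]}) N y :
    shear l (unshear l x%:P ^+ N * y) = x ^+ N *: shear l y.
  by rewrite rmorphM rmorphXn /= shearK // -rmorphXn mul_polyC.
have ME N y : shear l (unshear l q1 ^+ N * y) = q1 ^+ N * shear l y.
  by rewrite rmorphM rmorphXn /= shearK.
have q1E : unshear l q1 = c *: p by apply: unshearK.
have b'E : b' = c' *: b by apply: unshearK.
have sb : shear l' b' = q2 by apply: shearK.
have se : shear l' e' = e%:P by apply: shearK.
have bN0' : b' != 0.
  by rewrite b'E scaler_eq0 negb_or c'N0.
split; [| |exact: Je|].
- rewrite q1E -mul_mpolyC; exact: idealM Ji _ _ Jp.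
- rewrite b'E -mul_mpolyC polyCM; have -> := rmorphM (unshear l) (c'%:MP)%:P b%:P.
  exact: idealM Ji _ _ Jb.
split=> [|N u v uv|N x u v xuv].
- by rewrite q1E scaler_eq0 negb_or cN0.
- have := congr1 (shear l) uv; rewrite ME ZE.
  case/monic_dvd_scale => [||w vE]; first exact: monic_exp.
    by rewrite expf_neq0.
  exists (unshear l w); apply: (can_inj (unshearK lN0)).
  by rewrite ME vE shearK.
have := congr1 (shear l) xuv; rewrite ZE rmorphD /= ME ZE.
case/monic_scale_sum => [|y z yz|s [t xE]]; first exact: monic_exp.
  have : q2 ^+ N * shear l' z = e ^+ N *: shear l' y.
    have := congr1 (shear l') yz; rewrite !rmorphM !rmorphXn /= sb se => <-.
    by rewrite -rmorphXn mul_polyC.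
  case/monic_dvd_scale => [||w yE]; first exact: monic_exp.
    by rewrite expf_neq0.
  exists (unshear l' w); apply: (can_inj (unshearK l'N0)).
  by rewrite rmorphM rmorphXn /= sb yE shearK.
exists (unshear l s), (unshear l t); apply: (can_inj (unshearK lN0)).
by rewrite rmorphD /= ME ZE xE !shearK.
Qed.

(** * Polynomial and regular maps *)

Definition polyf (k : fieldType) (U : vectType k) (f : U -> k) : Prop :=
  exists p : polyfun U, forall u, f u = peval p u.

Lemma polyf_cst (k : fieldType) (U : vectType k) c : polyf (fun _ : U => c).
Proof. by exists c%:MP => u; rewrite /peval mevalC. Qed.

Lemma polyfD (k : fieldType) (U : vectType k) (f g : U -> k) :
  polyf f -> polyf g -> polyf (fun u => f u + g u).
Proof. by move=> [p fp] [q gq]; exists (p + q) => u; rewrite /peval mevalD fp gq. Qed.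

Lemma polyfM (k : fieldType) (U : vectType k) (f g : U -> k) :
  polyf f -> polyf g -> polyf (fun u => f u * g u).
Proof. by move=> [p fp] [q gq]; exists (p * q) => u; rewrite /peval mevalM fp gq. Qed.

Lemma polyf_sum (k : fieldType) (U : vectType k) (I : Type) (s : seq I) (f : I -> U -> k) :
  (forall i, polyf (f i)) -> polyf (fun u => \sum_(i <- s) f i u).
Proof.
move=> fp; elim: s => [|i s IHs].
  by have [p pE] := polyf_cst U 0; exists p => u; rewrite big_nil -pE.
by have [p pE] := polyfD (fp i) IHs; exists p => u; rewrite big_cons -pE.
Qed.

Lemma scalar_coord (k : fieldType) (U : vectType k) (f : U -> k) u : scalar f ->
  f u = \sum_(i < dim U) f (r2v (delta_mx 0 i)) * v2r u 0 i.
Proof.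
move=> fL; have f0 : f 0 = 0.
  by have := fL (-1) 0 0; rewrite scaler0 addr0 mulN1r addNr.
have fD : {morph f : x y / x + y} by move=> x y; rewrite -[x]scale1r fL mul1r scale1r.
have fZ c x : f (c *: x) = c * f x by rewrite -[c *: x]addr0 fL f0 addr0.
have {1}-> : u = \sum_i v2r u 0 i *: r2v (delta_mx 0 i).
  rewrite -{1}[u]v2rK {1}(row_sum_delta (v2r u)) linear_sum.
  by apply: eq_bigr => i _; rewrite linearZ.
by rewrite (big_morph f fD f0); apply: eq_bigr => i _; rewrite fZ mulrC.
Qed.

Lemma polyf_scalar (k : fieldType) (U W : vectType k) (F : U -> W) (f : W -> k) :
  scalar f -> Mor F -> polyf (fun u => f (F u)).
Proof.
move=> fL [P FP].
have [|p pE] := @polyf_sum _ U _ (index_enum 'I_(dim W))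
    (fun i u => f (r2v (delta_mx 0 i)) * peval (P i) u).
  by move=> i; apply: polyfM; [apply: polyf_cst | exists (P i)].
exists p => u; rewrite -pE (scalar_coord _ fL); apply: eq_bigr => i _.
by rewrite FP /pmeval r2vK mxE.
Qed.

Lemma v2r_scalar (k : fieldType) (W : vectType k) j : scalar (fun w : W => v2r w 0 j).
Proof. by move=> c x y; rewrite linearP !mxE. Qed.

Lemma Mor_coord (k : fieldType) (U W : vectType k) (F : U -> W) :
  (forall j, polyf (fun u => v2r (F u) 0 j)) -> Mor F.
Proof.
move=> Fp; pose P j := sval (constructive_indefinite_description _ (Fp j)).
have PE j u : v2r (F u) 0 j = peval (P j) u.
  by rewrite /P; case: constructive_indefinite_description.
exists P => u; apply: (can_inj v2rK); apply/rowP => j.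
by rewrite /pmeval r2vK mxE PE.
Qed.

Lemma Mor_id (k : fieldType) (U : vectType k) : Mor (fun u : U => u).
Proof. by apply: Mor_coord => j; exists 'X_j => u; rewrite /peval mevalXU. Qed.

Lemma Mor_cst (k : fieldType) (U W : vectType k) (w : W) : Mor (fun _ : U => w).
Proof. by apply: Mor_coord => j; apply: polyf_cst. Qed.

Lemma Mor_pair (k : fieldType) (U W1 W2 : vectType k) (F1 : U -> W1) (F2 : U -> W2) :
  Mor F1 -> Mor F2 -> Mor (fun u => (F1 u, F2 u) : (W1 * W2)%type).
Proof.
move=> F1m F2m; apply: Mor_coord => j.
pose l1 (w : W1) := v2r ((w, 0) : (W1 * W2)%type) 0 j.
pose l2 (w : W2) := v2r ((0, w) : (W1 * W2)%type) 0 j.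
have l1L : scalar l1.
  by move=> c x y; rewrite /l1 -v2r_scalar; congr (v2r _ 0 j);
    congr pair; rewrite /= ?scaler0 ?addr0.
have l2L : scalar l2.
  by move=> c x y; rewrite /l2 -v2r_scalar; congr (v2r _ 0 j);
    congr pair; rewrite /= ?scaler0 ?addr0.
have [p pE] := polyfD (polyf_scalar l1L F1m) (polyf_scalar l2L F2m).
exists p => u; rewrite -pE /l1 /l2 -[X in _ = X + _]mul1r -v2r_scalar scale1r.
by congr (v2r _ 0 j); congr pair; rewrite /= ?addr0 ?add0r.
Qed.

Lemma polyf_comp (k : fieldType) (U W : vectType k) (F : U -> W) (f : W -> k) :
  Mor F -> polyf f -> polyf (fun u => f (F u)).
Proof.
move=> [P FP] [q fq]; exists (mmap (@mpolyC _ k) P q) => u.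
rewrite fq /peval meval_mmap; apply: meval_eq => j.
by rewrite FP /pmeval r2vK mxE.
Qed.

Lemma Mor_comp (k : fieldType) (U W W' : vectType k) (F : U -> W) (H : W -> W') :
  Mor F -> Mor H -> Mor (fun u => H (F u)).
Proof.
move=> Fm Hm; apply: Mor_coord => j.
exact: polyf_comp Fm (polyf_scalar (v2r_scalar j) Hm).
Qed.

(** * Families of linear maps *)

Definition evx (k : fieldType) (U : vectType k) (m n : nat)
    (A : 'M[{mpoly k[dim U]}]_(m, n)) (u : U) : 'M[k]_(m, n) :=
  map_mx (meval (v2r u 0)) A.

Definition maxrank (k : fieldType) (U : vectType k) (m : nat)
    (T : 'M[{mpoly k[dim U]}]_m) (u : U) : Prop :=
  forall y : U, (\rank (evx T y) <= \rank (evx T u))%N.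

Lemma evxM (k : fieldType) (U : vectType k) (m n p : nat)
    (A : 'M[{mpoly k[dim U]}]_(m, n)) (B : 'M_(n, p)) u :
  evx (A *m B) u = evx A u *m evx B u.
Proof. exact: map_mxM. Qed.

Lemma evxZ (k : fieldType) (U : vectType k) (m n : nat)
    (A : 'M[{mpoly k[dim U]}]_(m, n)) q u :
  evx (q *: A) u = peval q u *: evx A u.
Proof. exact: map_mxZ. Qed.

(** If A is a partial identity between invertible factors, S is the complementary partial identity
    between the same factors. *)
Lemma complementary_rank (k : fieldType) (m : nat) (A : 'M[k]_m) :
  exists2 S : 'M[k]_m, A + S \in unitmx & (\rank S + \rank A <= m)%N.
Proof.
exists (col_ebase A *m copid_mx (\rank A) *m row_ebase A).
  rewrite -{1}(mulmx_ebase A) -mulmxDl -mulmxDr /copid_mx addrC subrK mulmx1.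
  by rewrite unitmx_mul col_ebase_unit row_ebase_unit.
rewrite mxrankMfree ?row_free_unit ?row_ebase_unit //.
rewrite -mxrank_tr trmx_mul mxrankMfree ?row_free_unit ?unitmx_tr ?col_ebase_unit //.
by rewrite mxrank_tr rank_copid_mx ?rank_leq_row // subnK // rank_leq_row.
Qed.

(* Near x, T + S is invertible for a constant S of complementary rank; where T
   has maximal rank the row spaces of T and S meet trivially, so that
   v (T + S)^-1 T = v for v in the row space of T. *)
Lemma local_lift (k : fieldType) (U : vectType k) (m : nat)
    (T : 'M[{mpoly k[dim U]}]_m) (x : U) : maxrank T x ->
  exists (f : {mpoly k[dim U]}) (B : 'M[{mpoly k[dim U]}]_m),
    [/\ peval f x != 0, forall u, peval f u != 0 -> maxrank T u
      & forall u (v : 'rV_m), maxrank T u -> (v <= evx T u)%MS ->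
          peval f u *: v = v *m evx B u *m evx T u].
Proof.
move=> xmax; have [S TS rS] := complementary_rank (evx T x).
pose TS' := T + map_mx (@mpolyC _ k) S.
have evTS u : evx TS' u = evx T u + S.
  by apply/matrixP => i j; rewrite !mxE mevalD mevalC.
have evdet u : peval (\det TS') u = \det (evx T u + S).
  by rewrite -evTS /evx det_map_mx.
have unitE u : (peval (\det TS') u != 0) = (evx T u + S \in unitmx).
  by rewrite evdet unitmxE unitfE.
have rankS u : evx T u + S \in unitmx -> (m <= \rank (evx T u + S)%MS)%N.
  move=> uTS; rewrite -{1}(mxrank_unit uTS); apply: mxrankS.
  exact: addmx_sub_adds.
(* Invertibility of T(u) + S forces rank T(u) >= m - rank S >= rank T(x). *)
have ext u : peval (\det TS') u != 0 -> maxrank T u.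
  rewrite unitE => /rankS le_m y; apply: leq_trans (xmax y) _.
  have := mxrank_sum_cap (evx T u) S => sumr.
  move: (leq_trans le_m (leq_addr (\rank (evx T u :&: S)) _)).
  by rewrite sumr => le_m'; rewrite -(leq_add2l (\rank S)) (leq_trans rS) // addnC.
(* The extra factor [\det TS'] makes the lifting identity hold, as 0 = 0, also where the determinant
   vanishes. *)
exists (\det TS' ^+ 2), (\det TS' *: \adj TS'); split=> [|u|u v umax vT].
- by rewrite /peval rmorphXn expf_neq0 //= -/(peval _ x) unitE.
- by rewrite /peval rmorphXn expf_eq0 /= => /ext.
have -> : evx (\det TS' *: \adj TS') u = \det (evx T u + S) *: \adj (evx T u + S).
  by rewrite evxZ evdet /evx map_mx_adj -/(evx TS' u) evTS.
rewrite /peval rmorphXn /= -/(peval _ u) evdet; set M := evx T u + S; set d := \det M.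
have [->|dN0] := eqVneq d 0; first by rewrite expr0n !scale0r mulmx0 mul0mx.
have uM : M \in unitmx by rewrite unitmxE unitfE.
rewrite -scalemxAr -scalemxAl expr2 -scalerA; congr (_ *: _).
pose w := v *m \adj M.
have wM : w *m evx T u + w *m S = d *: v.
  by rewrite -mulmxDr -mulmxA mul_adj_mx mul_mx_scalar.
suff wS0 : w *m S = 0 by rewrite -wM wS0 addr0.
apply/eqP; rewrite -submx0; apply: (@submx_trans _ _ _ _ _ _ (evx T u :&: S)%MS).
  rewrite sub_capmx submxMl andbT.
  have -> : w *m S = d *: v - w *m evx T u by rewrite -wM addrC addKr.
  by rewrite addmx_sub ?scalemx_sub ?eqmx_opp ?submxMl.
rewrite submx0 -mxrank_eq0 -leqn0.
rewrite -(leq_add2l (\rank (evx T u + S)%MS)) mxrank_sum_cap addn0.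
apply: leq_trans (rankS u uM); apply: leq_trans rS; rewrite addnC leq_add2l.
exact: xmax.
Qed.

(** * Extension of regular functions and gluing of lifts *)

Lemma eq_on_open (k : closedFieldType) (U : vectType k) (X : U -> Prop)
    (p a b : {mpoly k[dim U]}) :
  p != 0 -> (forall u, peval p u != 0 -> X u) ->
  (forall u, X u -> peval a u = peval b u) -> a = b.
Proof.
move=> pN0 pX ab; apply: (mulfI pN0); apply: meval_inj => v.
rewrite -!(@peval_pt _ U); set u := r2v _; rewrite /peval !mevalM -!/(peval _ u).
by have [->|/pX/ab->] := eqVneq (peval p u) 0; rewrite ?mul0r.
Qed.

(** For J an ideal of admissible denominators, this turns local solvability on X into a global
    solution with denominator a power of p. *)
Lemma exists_power_mem (k : closedFieldType) (U : vectType k) (X : U -> Prop)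
    (J : {mpoly k[dim U]} -> Prop) p :
  is_ideal J -> (forall x, X x -> exists2 q, J q & peval q x != 0) ->
  (forall u, peval p u != 0 -> X u) -> exists N, J (p ^+ N).
Proof.
move=> Ji JX pX; apply: nullstellensatz => // a Ja.
rewrite -(@peval_pt _ U); apply/eqP/negPn/negP => /pX/JX[q Jq].
by rewrite peval_pt Ja ?eqxx.
Qed.

(** A Hartogs argument: writing f as g1 / p1^N and as g2 / p2^N, regularity of the pair makes p1^N
    divide g1, and the quotient is the extension. *)
Lemma regular_extend (k : closedFieldType) (U : vectType k) (X : U -> Prop)
    (p1 p2 p3 : {mpoly k[dim U]}) (f : U -> k) :
  strong_regular p1 p2 p3 ->
  (forall u, peval p1 u != 0 -> X u) -> (forall u, peval p2 u != 0 -> X u) ->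
  (forall x, X x -> exists q g : {mpoly k[dim U]}, peval q x != 0 /\
     forall y, X y -> peval q y != 0 -> f y = (peval q y)^-1 * peval g y) ->
  exists g, forall x, X x -> f x = peval g x.
Proof.
move=> [p1N0 p12 _] p1X p2X floc.
pose J (q : {mpoly k[dim U]}) :=
  exists g : {mpoly k[dim U]}, forall y, X y -> peval q y * f y = peval g y.
have Ji : is_ideal J.
  split=> [|q r [g qg] [h rh]|a q [g qg]].
  - by exists 0 => y _; rewrite /peval !meval0 mul0r.
  - by exists (g + h) => y Xy; rewrite /peval !mevalD mulrDl -!/(peval _ y) qg ?rh.
  - by exists (a * g) => y Xy; rewrite /peval !mevalM -mulrA -!/(peval _ y) qg.
have Jloc x : X x -> exists q g, [/\ peval q x != 0 &
    forall y, X y -> peval (q ^+ 2) y * f y = peval (q * g) y].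
  move=> /floc[q [g [qx fq]]]; exists q, g; split=> // y Xy.
  rewrite /peval rmorphXn mevalM /= -!/(peval _ y).
  have [->|qy] := eqVneq (peval q y) 0; first by rewrite expr0n !mul0r.
  by rewrite fq // expr2 -mulrA mulVKf.
have JX x : X x -> exists2 q, J q & peval q x != 0.
  move=> /Jloc[q [g [qx qg]]]; exists (q ^+ 2); first by exists (q * g).
  by rewrite /peval rmorphXn expf_neq0.
have [N1 Jp1] := exists_power_mem Ji JX p1X.
have [N2 Jp2] := exists_power_mem Ji JX p2X.
pose N := (N1 + N2)%N.
have [g1 g1E] : J (p1 ^+ N) by rewrite /N addnC exprD; apply: idealM.
have [g2 g2E] : J (p2 ^+ N) by rewrite /N exprD; apply: idealM.
have g12 : p1 ^+ N * g2 = p2 ^+ N * g1.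
  apply: (eq_on_open p1N0 p1X) => y Xy.
  by rewrite /peval !mevalM -!/(peval _ y) -g1E -?g2E // mulrCA.
have [w g1w] := p12 _ _ _ g12; exists w => x Xx.
(* At points where p1 vanishes, [w] is compared with f through a local denominator q that is nonzero
   at x. *)
have [q [g [qx qg]]] := Jloc x Xx.
have qw : q * w = g.
  have PN0 : p1 ^+ N * q != 0.
    by rewrite mulf_neq0 ?expf_neq0 //; apply: contraNneq qx => ->; rewrite /peval meval0.
  apply: (mulfI PN0); apply: (eq_on_open p1N0 p1X) => y Xy.
  have -> : p1 ^+ N * q * (q * w) = q ^+ 2 * g1 by rewrite g1w; ring.
  rewrite -[p1 ^+ N * q * g]mulrA /peval [LHS]mevalM [RHS]mevalM -!/(peval _ y) -qg // -g1E //.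
  by rewrite mulrCA.
have := qg x Xx; rewrite -qw /peval rmorphXn !mevalM /= -!/(peval _ x) mulrA -expr2.
by apply: mulfI; rewrite expf_neq0.
Qed.

Lemma exists_row (R : Type) (m : nat) (P : 'I_m -> R -> Prop) :
  (forall i, exists x, P i x) -> exists r : 'rV[R]_m, forall i, P i (r 0 i).
Proof.
move=> Px; exists (\row_i sval (constructive_indefinite_description _ (Px i))) => i.
by rewrite mxE; case: constructive_indefinite_description.
Qed.

(* The cocycle C_ij of differences of the local lifts G_i / P_i, expressed in
   a basis Phi of the kernel, is a coboundary by exactness of the Koszul
   complex of P_1, P_2, P_3. *)
Lemma koszul_glue (R : idomainType) (m r : nat) (T : 'M[R]_m) (Phi : 'M[R]_(r, m))
    (F G1 G2 G3 : 'rV[R]_m) (p1 p2 p3 : R) N :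
  strong_regular p1 p2 p3 ->
  Phi *m T = 0 ->
  (forall H : 'rV_m, H *m T = 0 -> exists C, H = C *m Phi) ->
  (forall C : 'rV_r, C *m Phi = 0 -> C = 0) ->
  p1 ^+ N *: F = G1 *m T -> p2 ^+ N *: F = G2 *m T -> p3 ^+ N *: F = G3 *m T ->
  exists G, F = G *m T.
Proof.
move=> [p1N0 p12 p123] PhiT kerT freePhi GE1 GE2 GE3.
have ker a b G G' : a *: F = G *m T -> b *: F = G' *m T ->
    exists C, b *: G - a *: G' = C *m Phi.
  by move=> aG bG'; apply: kerT; rewrite mulmxBl -!scalemxAl -aG -bG' !scalerA mulrC subrr.
have [C12 C12E] := ker _ _ _ _ GE1 GE2.
have [C13 C13E] := ker _ _ _ _ GE1 GE3.
have [C23 C23E] := ker _ _ _ _ GE2 GE3.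
have cocycle : p3 ^+ N *: C12 - p2 ^+ N *: C13 + p1 ^+ N *: C23 = 0.
  apply: freePhi; rewrite mulmxDl mulmxBl -!scalemxAl -C12E -C13E -C23E.
  by apply/rowP => i; rewrite !mxE; ring.
(* The cocycle relation puts p3^N C12 in the ideal of p1^N and p2^N; regularity of p3^N removes the
   factor. *)
have split12 i : exists st, C12 0 i = p1 ^+ N * st.1 + p2 ^+ N * st.2.
  have [|s [t stE]] := p123 N (C12 0 i) (- C23 0 i) (C13 0 i); last by exists (s, t).
  have /rowP/(_ i) := cocycle; rewrite !mxE => /eqP.
  by rewrite addr_eq0 subr_eq => /eqP->; rewrite mulrN.
have [st stE] := exists_row split12.
pose s := \row_i (st 0 i).1; pose t := \row_i (st 0 i).2.
have C12st : C12 = p1 ^+ N *: s + p2 ^+ N *: t by apply/rowP => i; rewrite stE !mxE.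
(* The correction by [s] and [t] stays in the kernel of T and makes the lifts over p1 <> 0 and p2 <>
   0 equal as fractions. *)
have glue : p2 ^+ N *: (G1 - t *m Phi) = p1 ^+ N *: (G2 + s *m Phi).
  move: C12E; rewrite C12st mulmxDl -!scalemxAl.
  move: (s *m Phi) (t *m Phi) => sPhi tPhi C12E; apply/rowP => i.
  have /rowP/(_ i) := C12E; rewrite !mxE => /eqP; rewrite subr_eq => /eqP E.
  by rewrite mulrBr E; ring.
have divp1 i : exists w, (G1 - t *m Phi) 0 i = p1 ^+ N * w.
  apply: (p12 N ((G2 + s *m Phi) 0 i)).
  by have /rowP/(_ i) := glue; rewrite !mxE.
have [G GE] := exists_row divp1; exists G.
have p1G : G1 - t *m Phi = p1 ^+ N *: G by apply/rowP => i; rewrite GE !mxE.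
have PN0 : p1 ^+ N != 0 by rewrite expf_neq0.
have : p1 ^+ N *: F = p1 ^+ N *: (G *m T).
  by rewrite scalemxAl -p1G mulmxBl -mulmxA PhiT mulmx0 subr0.
by move/rowP => FE; apply/rowP => i; have := FE i; rewrite !mxE => /(mulfI PN0).
Qed.

(** This restricts a map regular on a bundle to a polynomial section [s], giving the local quotients
    that [regular_extend] takes. *)
Lemma regular_pullback (k : fieldType) (U W W' : vectType k) (X : U -> Prop)
    (Y : W -> Prop) (F : W -> W') (s : U -> W) (l : W' -> k) :
  regular_on Y F -> Mor s -> scalar l -> (forall x, X x -> Y (s x)) ->
  forall x, X x -> exists q g : {mpoly k[dim U]}, peval q x != 0 /\
    forall y, X y -> peval q y != 0 -> l (F (s y)) = (peval q y)^-1 * peval g y.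
Proof.
move=> Freg sm lL XY x Xx; have [q [P [qx FE]]] := Freg _ (XY x Xx).
have [q' q'E] := polyf_comp sm (ex_intro _ q (fun=> erefl) : polyf (peval q)).
have [g gE] := polyf_scalar lL (Mor_comp sm (ex_intro _ P (fun=> erefl) : Mor (pmeval P))).
exists q', g; rewrite -q'E; split=> // y Xy; rewrite -q'E => qy.
have l0 : l 0 = 0 by have := lL (-1) 0 0; rewrite scaler0 addr0 mulN1r addNr.
by rewrite (FE _ (XY y Xy) qy) -gE -[_ *: _]addr0 lL l0 addr0.
Qed.

Lemma linear_row_coord (k : fieldType) (r : nat) (V : lmodType k) (f : 'rV[k]_r -> V) w :
  (forall c u v, f (c *: u + v) = c *: f u + f v) ->
  f w = \sum_i w 0 i *: f (delta_mx 0 i).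
Proof.
move=> fL; have f0 : f 0 = 0.
  by have := fL (-1) 0 0; rewrite scaler0 addr0 scaleN1r addNr.
have fD : {morph f : x y / x + y} by move=> x y; rewrite -[x]scale1r fL !scale1r.
rewrite {1}(row_sum_delta w) (big_morph f fD f0); apply: eq_bigr => i _.
by rewrite -[_ *: delta_mx _ _]addr0 fL f0 addr0.
Qed.

Lemma evx_eq_on (k : closedFieldType) (U : vectType k) (X : U -> Prop) p (m n : nat)
    (A B : 'M[{mpoly k[dim U]}]_(m, n)) :
  p != 0 -> (forall u, peval p u != 0 -> X u) ->
  (forall u, X u -> evx A u = evx B u) -> A = B.
Proof.
move=> pN0 pX AB; apply/matrixP => i j; apply: (eq_on_open pN0 pX) => u Xu.
by have /matrixP/(_ i j) := AB u Xu; rewrite !mxE.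
Qed.

(** * From linear families of endomorphisms to matrices and lifts *)

Lemma v2r_lfun (k : fieldType) (V W : vectType k) (f : 'Hom(V, W)) v :
  v2r (f v) = v2r v *m f2mx f.
Proof. by rewrite unlock /= r2vK. Qed.

Lemma dim_lker (k : fieldType) (V W : vectType k) (f : 'Hom(V, W)) :
  \dim (lker f) = (dim V - \rank (f2mx f))%N.
Proof. by rewrite /dimv /lker mx2vsK mxrank_ker. Qed.

Lemma linear_family_mx (k : fieldType) (U V : vectType k) (L : U -> 'End(V)) :
  (forall c u v w, L (c *: u + v) w = c *: L u w + L v w) ->
  exists T : 'M[{mpoly k[dim U]}]_(dim V), forall u, evx T u = f2mx (L u).
Proof.
move=> LL; have coordL i j : polyf (fun u => f2mx (L u) i j).
  have E u : f2mx (L u) i j = v2r (L u (r2v (delta_mx 0 i))) 0 j.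
    by rewrite v2r_lfun r2vK -rowE mxE.
  have [|p pE] := polyf_scalar (f := fun u => v2r (L u (r2v (delta_mx 0 i))) 0 j) _ (Mor_id U).
    by move=> c u v; rewrite LL linearP !mxE.
  by exists p => u; rewrite E pE.
exists (\matrix_(i, j) sval (constructive_indefinite_description _ (coordL i j))) => u.
by apply/matrixP => i j; rewrite !mxE; case: constructive_indefinite_description => p /= ->.
Qed.

Lemma Mor_evx (k : fieldType) (U V : vectType k) (H : 'rV[{mpoly k[dim U]}]_(dim V)) :
  Mor (fun u : U => r2v (evx H u) : V).
Proof. by apply: Mor_coord => j; exists (H 0 j) => u; rewrite r2vK mxE. Qed.

Lemma Mor_linear_family (k : fieldType) (U V : vectType k) (L : U -> 'End(V)) (F : U -> V) :
  (forall c u v w, L (c *: u + v) w = c *: L u w + L v w) ->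
  Mor F -> Mor (fun u => L u (F u)).
Proof.
move=> /linear_family_mx[T TE] [P FP].
have [Q QE] := @Mor_evx _ U V (\row_j P j *m T).
exists Q => u; rewrite -QE; apply: (can_inj v2rK).
rewrite r2vK v2r_lfun evxM TE FP /pmeval r2vK; congr (_ *m _).
by apply/rowP => j; rewrite !mxE.
Qed.

(** At a point of maximal rank, the [f] of [local_lift] is nonzero there and vanishes on the
    complement of the maximal rank locus. *)
Lemma zclosed_not_maxrank (k : fieldType) (U : vectType k) (m : nat)
    (T : 'M[{mpoly k[dim U]}]_m) : zclosed (fun u : U => ~ maxrank T u).
Proof.
exists (vanishing (fun u => ~ maxrank T u)) => u; split=> [nTu p|van Tu]; first exact.
have [f [_ [fu fT _]]] := local_lift Tu.
move: fu; rewrite van ?eqxx // => v nTv.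
by apply/eqP/negPn/negP => /fT.
Qed.

(** Only the linearity of the action in x matters here, whence the statement for an arbitrary linear
    family L. *)
Lemma lift_through_family (k : closedFieldType) (U V : vectType k) (L : U -> 'End(V))
    (X : U -> Prop) (cF : U -> V) :
  (forall c u v w, L (c *: u + v) w = c *: L u w + L v w) ->
  (forall x, X x <-> forall y, (\dim (lker (L x)) <= \dim (lker (L y)))%N) ->
  trivial_bundle X (fun e : U * V => X e.1 /\ L e.1 e.2 = 0) ->
  codim_ge (fun x => ~ X x) 3 ->
  Mor cF -> (forall x, X x -> cF x \in limg (L x)) ->
  exists F, Mor F /\ forall x, cF x = L x (F x).
Proof.
move=> LL XE [r [phi [psi [phireg psireg phiE psiE philin]]]] codimX [P cFE] cFimg.
have [T TE] := linear_family_mx LL.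
have XT x : X x <-> maxrank T x.
  have leE y : (\dim (lker (L x)) <= \dim (lker (L y)))%N
      = (\rank (evx T y) <= \rank (evx T x))%N.
    by rewrite !dim_lker -!TE leq_sub2lE // rank_leq_row.
  by rewrite XE /maxrank; split=> H y; have := H y; rewrite leE.
have Zclosed : zclosed (fun x => ~ X x).
  have [S SE] := zclosed_not_maxrank T; exists S => u; rewrite -SE.
  by split=> nX /XT.
have [|p1 [p2 [p3 [van1 van2 van3 reg]]]] :=
    exists_strong_regular (vanishing_ideal (fun x => ~ X x)).
  by move=> N f fC fJ; apply: (codim_indep_leq Zclosed codimX (f := f)).
have supp p : vanishing (fun x => ~ X x) p -> forall u, peval p u != 0 -> X u.
  by move=> van u pu; apply: NNPP => /van/eqP; rewrite (negbTE pu).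
have p1N0 : p1 != 0 by case: reg.
have eqX := evx_eq_on p1N0 (supp p1 van1).
have extend (f : U -> k) := regular_extend (f := f) reg (supp p1 van1) (supp p2 van2).
(* The rows of [Phi] are the images under [phi] of the constant basis sections, extended to
   polynomials on all of U. *)
have [Phi PhiE] : exists Phi : 'M[{mpoly k[dim U]}]_(r, dim V), forall x, X x ->
    forall w, v2r (phi (x, w)).2 = w *m evx Phi x.
  have coord l j : exists g, forall x, X x -> v2r (phi (x, delta_mx 0 l)).2 0 j = peval g x.
    apply: extend; apply: (regular_pullback phireg (Mor_pair (Mor_id U) (Mor_cst _ _))
      (l := fun e : U * V => v2r e.2 0 j)) => // c e e'.
    by rewrite /= linearP !mxE.
  exists (\matrix_(l, j) sval (constructive_indefinite_description _ (coord l j))) => x Xx w.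
  rewrite (linear_row_coord w (philin x Xx)) linear_sum; apply/rowP => j.
  rewrite summxE mxE; apply: eq_bigr => l _; rewrite linearZ !mxE; congr (_ * _).
  by case: constructive_indefinite_description => g gE /=; rewrite gE.
have [cFm cFmE] : exists cFm : 'rV[{mpoly k[dim U]}]_(dim V), forall u, evx cFm u = v2r (cF u).
  by exists (\row_j P j) => u; rewrite cFE /pmeval r2vK; apply/rowP => j; rewrite !mxE.
have PhiT : Phi *m T = 0.
  apply: eqX => x Xx; rewrite evxM; apply/row_matrixP => l.
  have [[_ phi0] phi1 _] := phiE (x, delta_mx 0 l) Xx.
  rewrite phi1 in phi0; rewrite row_mul rowE -PhiE // TE -v2r_lfun phi0 /evx map_mx0 row0.
  exact: linear0.
(* The coordinates of H are read off through [psi], regular on X, and extend to polynomials. *)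
have kerT (H : 'rV_(dim V)) : H *m T = 0 -> exists C, H = C *m Phi.
  move=> HT; pose h u := r2v (evx H u) : V.
  have EH x : X x -> X x /\ L x (h x) = 0.
    split=> //; apply: (can_inj v2rK); rewrite v2r_lfun r2vK -TE -evxM HT.
    by rewrite /evx map_mx0; apply/esym/linear0.
  have coord l : exists g, forall x, X x -> (psi (x, h x)).2 0 l = peval g x.
    apply: extend; apply: (regular_pullback psireg (Mor_pair (Mor_id U) (Mor_evx H))
      (l := fun e : U * 'rV_r => e.2 0 l)) => // c e e'.
    by rewrite /= !mxE.
  have [C CE] := exists_row coord; exists C; apply: eqX => x Xx.
  have [_ psi1 psiK] := psiE (x, h x) (EH x Xx).
  rewrite evxM; have -> : evx C x = (psi (x, h x)).2.
    by apply/rowP => l; rewrite mxE CE.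
  have psi_pair : (x, (psi (x, h x)).2) = psi (x, h x).
    by rewrite [RHS]surjective_pairing psi1.
  by rewrite -PhiE // psi_pair psiK r2vK.
have freePhi (C : 'rV_r) : C *m Phi = 0 -> C = 0.
  move=> CPhi; apply: eqX => x Xx.
  have [_ phi1 psiC] := phiE (x, evx C x) Xx; have [_ phi01 psi0] := phiE (x, 0) Xx.
  have phi0 : phi (x, evx C x) = phi (x, 0).
    rewrite [LHS]surjective_pairing [RHS]surjective_pairing phi1 phi01; congr pair.
    by apply: (can_inj v2rK); rewrite !PhiE // -evxM CPhi mul0mx /evx map_mx0.
  by have := psi0; rewrite -phi0 psiC => -[->]; rewrite /evx map_mx0.
(* [J] is the ideal of denominators with which cF lifts; [local_lift] shows that it has no common
   zero on X. *)
pose J q := exists G : 'rV_(dim V), q *: cFm = G *m T.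
have Ji : is_ideal J.
  split=> [|q q' [G GE] [G' GE']|a q [G GE]].
  - by exists 0; rewrite scale0r mul0mx.
  - by exists (G + G'); rewrite scalerDl mulmxDl GE GE'.
  - by exists (a *: G); rewrite -scalerA GE scalemxAl.
have JX x : X x -> exists2 q, J q & peval q x != 0.
  move=> /XT/local_lift[f [B [fx _ fB]]]; exists f => //; exists (cFm *m B).
  apply: eqX => u Xu; rewrite evxZ !evxM cFmE; apply: fB; first exact/XT.
  have /memv_imgP[w _ ->] := cFimg u Xu.
  by rewrite v2r_lfun TE submxMl.
have [N1 J1] := exists_power_mem Ji JX (supp p1 van1).
have [N2 J2] := exists_power_mem Ji JX (supp p2 van2).
have [N3 J3] := exists_power_mem Ji JX (supp p3 van3).
pose N := (N1 + N2 + N3)%N.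
have [G1 GE1] : J (p1 ^+ N) by rewrite /N -addnA addnC exprD; apply: idealM.
have [G2 GE2] : J (p2 ^+ N) by rewrite /N addnAC exprD; apply: idealM.
have [G3 GE3] : J (p3 ^+ N) by rewrite /N exprD; apply: idealM.
have [G GE] := koszul_glue reg PhiT kerT freePhi GE1 GE2 GE3.
exists (fun u => r2v (evx G u)); split; first exact: Mor_evx.
by move=> x; apply: (can_inj v2rK); rewrite v2r_lfun r2vK -cFmE GE evxM TE.
Qed.

Lemma act_linear (k : fieldType) (G : affineAlgGroup k) (V : vectType k)
    (rho : rationalModule G V) c u v :
  act rho (c *: u + v) = c *: act rho u + act rho v.
Proof.
rewrite /act /agdiff; case: constructive_indefinite_description => P _ /=.
apply: (can_inj v2rK); rewrite linearP /= /pmdiff !r2vK; apply/rowP => j.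
by rewrite !mxE pdiff_linear.
Qed.

Theorem proposition3p4 (k : closedFieldType) (k_char0 : [pchar k] =i pred0)
  (G : affineAlgGroup k) (G_connected : agconnected G)
  (V : vectType k) (rho : rationalModule G V)
  (E'_trivial : trivial_bundle (Omega rho) (E' rho))
  (codim3 : codim_ge (fun x : lieType G => ~ Omega rho x) 3) :
  (forall cF : lieType G -> V,
     (exists F : lieType G -> V, Mor F /\ (forall x, tauhat rho F x = cF x))
     <-> (Mor cF /\ (forall x, cF x \in actV rho x)))
  /\
  (forall cF : lieType G -> V,
     Mor cF -> (forall x, Omega rho x -> cF x \in actV rho x) ->
     exists F : lieType G -> V,
       Mor F /\ (forall x, cF x = act rho x (F x))).
Proof.
have act_lin c u v w : act rho (c *: u + v) w = c *: act rho u w + act rho v w.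
  by rewrite act_linear add_lfunE scale_lfunE.
have lift (cF : lieType G -> V) : Mor cF ->
    (forall x, Omega rho x -> cF x \in actV rho x) ->
    exists F : lieType G -> V, Mor F /\ (forall x, cF x = act rho x (F x)).
  by move=> cFm; apply: (lift_through_family act_lin _ E'_trivial codim3 cFm).
split=> // cF; split=> [[F [Fm FE]]|[cFm cFimg]].
  split=> [|x]; last by rewrite -FE; apply/memv_img/memvf.
  have [M ME] := Mor_linear_family (act_lin) Fm.
  by exists M => u; rewrite -FE -ME.
have [|F [Fm FE]] := lift cF cFm; first by move=> x _; apply: cFimg.
by exists F; split=> // x; rewrite FE.
Qed.
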